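(* Let $\mathcal{M}=\langle\mathcal{X},X_W,\Phi,\mathcal{B}\rangle$ be a system of constraints with $\mathcal{B}=\langle V,F,E\rangle$, and let $h:\mathcal{X}_W\to\mathcal{X}_{V\setminus W}$ be a solution of $\mathcal{M}$; write $X^*_w=X_w$ for $w\in W$ and $X^*_{V\setminus W}=h(X_W)$. Let $\langle T_I,T_C,T_O\rangle$ be the coarse decomposition of the subgraph of $\mathcal{B}$ induced by $(V\setminus W)\cup F$, let $\mathrm{MO}_{\mathrm{CO}}(\mathcal{B})$ be the subgraph of the Markov ordering graph $\mathrm{MO}(\mathcal{B})$ induced by $((T_C\cup T_O)\cap V)\cup W$, and let $X^*_{\mathrm{CO}}$ be the corresponding components of $X^*$. If $\mathcal{M}$ is maximally uniquely solvable, then $(\mathrm{MO}_{\mathrm{CO}}(\mathcal{B}),\mathbb{P}_{X^*_{\mathrm{CO}}})$ satisfies the directed global Markov property: for all subsets $A,B,C$ of the vertex set of $\mathrm{MO}_{\mathrm{CO}}(\mathcal{B})$, if $A$ and $B$ are d-separated by $C$ in $\mathrm{MO}_{\mathrm{CO}}(\mathcal{B})$ then $X^*_A$ is independent of $X^*_B$ given $X^*_C$.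
   Context: System of constraints $\langle\mathcal{X},X_W,\Phi,\mathcal{B}\rangle$: $\mathcal{X}=\bigotimes_{v\in V}\mathcal{X}_v$ with each $\mathcal{X}_v$ a standard measurable space; $W\subseteq V$ (exogenous indices) and $X_W=(X_w)_{w\in W}$ independent random variables with values in $\mathcal{X}_W$; $\Phi=(\Phi_f)_{f\in F}$ with $\Phi_f=\langle\phi_f,c_f,V(f)\rangle$, $V(f)\subseteq V$, $c_f$ a constant in a standard measurable space $\mathcal{Y}$, $\phi_f:\mathcal{X}_{V(f)}\to\mathcal{Y}$ measurable; $\mathcal{B}=\langle V,F,E\rangle$ bipartite with $E=\{(f-v):v\in V(f)\}$. For $S_F\subseteq F$, $V(S_F)=\bigcup_{f\in S_F}V(f)$. A solution is a measurable $g:\mathcal{X}_W\to\mathcal{X}_{V\setminus W}$ with $\phi_f(g_{V(f)\setminus W}(X_W),X_{V(f)\cap W})=c_f$ for all $f\in F$, almost surely. $\mathcal{M}$ is solvable w.r.t. $S_F\subseteq F$ and $S_V\subseteq V(S_F)\setminus W$ if there is a measurable $g_{S_V}:\mathcal{X}_{V(S_F)\setminus S_V}\to\mathcal{X}_{S_V}$ such that, $\mathbb{P}_{X_W}$-a.s., for all $x_{V(S_F)\setminus W}$: $x_{S_V}=g_{S_V}(x_{V(S_F)\setminus(S_V\cup W)},X_{V(S_F)\cap W})$ implies $\phi_f(x_{V(f)\setminus W},X_{V(f)\cap W})=c_f$ for all $f\in S_F$; it is uniquely solvable w.r.t. $S_F,S_V$ if moreover the converse implication holds. Graph notions: $\mathrm{adj}_{\mathcal{B}}(X)$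 is the set of neighbours of $X$; $F'\subseteq F$ is self-contained if $|F'|=|\mathrm{adj}(F')|$ and $|F''|\le|\mathrm{adj}(F'')|$ for all $F''\subseteq F'$; a bipartite graph is self-contained if it has equally many vertices on both sides and its constraint side is self-contained; minimal self-contained = non-empty self-contained with no non-empty strict self-contained subset. Matching, maximum matching as usual; an alternating path for a matching $M$ is a sequence of distinct vertices (possibly one) with consecutive vertices adjacent and edges alternating between not in $M$ and in $M$. Coarse decomposition of a bipartite graph w.r.t. a maximum matching $M$: $T_I$ = vertices joined by an alternating path to an $M$-unmatched variable vertex, $T_O$ = vertices joined by an alternating path to an $M$-unmatched constraint vertex, $T_C$ = the rest (independent of $M$). Causal ordering graph $\mathrm{CO}(\mathcal{B})=\langle\mathcal{V},\mathcal{E}\rangle$ (Algorithm 3), a directed cluster graph (partition $\mathcal{V}$ of $V\cup F$ plus edges from vertices to clusters; $\mathrm{cl}(x)$ is the cluster of $x$): let $\mathcal{B}'$ be the subgraph induced by $(V\setminus W)\cup F$, $\langle T_I,T_C,T_O\rangle$ its coarse decomposition, $\mathcal{B}_I,\mathcal{B}_C,\mathcal{B}_O$ the induced subgraphs. Compute $\langle\mathcal{V}_C,\mathcal{E}_C\rangle$ by Algorithm 1 on $\mathcal{B}_C$: start with no clusters and edges, and while the current graph $\mathcal{B}''$ is non-null, choose a minimal self-contained set $S_F$ of $\mathcal{B}''$, form the cluster $C=S_F\cup\mathrm{adj}_{\mathcal{B}''}(S_F)$, add edges $v\to C$ for $v\in\mathrm{adj}_{\mathcal{B}_C}(S_F)\setminus\mathrm{adj}_{\mathcal{B}''}(S_F)$,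 and remove $C$. Let $\mathcal{V}=\mathcal{V}_C\cup\{\text{connected components of }\mathcal{B}_I\}\cup\{\text{connected components of }\mathcal{B}_O\}\cup\{\{w\}:w\in W\}$, $\mathcal{E}=\mathcal{E}_C$ plus: $v\to\mathrm{cl}(f)$ for each edge $(v-f)$ with $v\in(T_O\cup T_C)\cap V$, $f\in T_I\cap F$, or with $v\in T_O\cap V$, $f\in T_C\cap F$; and $w\to\mathrm{cl}(f)$ for each $w\in W$ and $f\in\mathrm{adj}_{\mathcal{B}}(w)$. $\mathcal{M}$ is maximally uniquely solvable if it is uniquely solvable w.r.t. $S\cap F$ and $S\cap V$ for every cluster $S\in\mathcal{V}$ with $S\cap W=\emptyset$ and $S\cap T_I=\emptyset$, and solvable w.r.t. $T_I\cap F$ and $(T_I\cap V)\setminus W$. Declustering: for a directed cluster graph $\langle\mathcal{V},\mathcal{E}\rangle$, $D(\langle\mathcal{V},\mathcal{E}\rangle)$ is the directed graph on $\bigcup\mathcal{V}$ with $x\to y$ iff $(x\to\mathrm{cl}(y))\in\mathcal{E}$. Marginalization (latent projection) of a set $U$ from a directed graph $\mathcal{G}$ gives the directed mixed graph on the remaining vertices with $x\to y$ iff $\mathcal{G}$ has a directed path from $x$ to $y$ all of whose intermediate vertices lie in $U$, and $x\leftrightarrow y$ iff $\mathcal{G}$ has a path $x\leftarrow u_1\leftarrow\dots\leftarrow u_i\to\dots\to u_k\to y$ with all $u_j\in U$. The Markov ordering graph is $\mathrm{MO}(\mathcal{B})=D(\mathrm{CO}(\mathcal{B}))$ with $F$ marginalized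 out. d-separation is the standard notion. *)

(* Defs.v *)
From HB Require Import structures.
From mathcomp Require Import all_boot all_order all_algebra.
From mathcomp Require Import all_classical all_reals all_analysis.
Set Implicit Arguments. Unset Strict Implicit.
Unset Printing Implicit Defensive.
Import Order.TTheory GRing.Theory Num.Theory.
Local Open Scope ring_scope.

Section Bipartite.
Variables (V F : finType) (Vf : F -> {set V}).

Definition vtx := (V + F)%type.

Definition adjB (x y : vtx) : bool :=
  match x, y with
  | inl v, inr f => v \in Vf f
  | inr f, inl v => v \in Vf f
  | _, _ => false
  end.

Definition adjV (U : {set vtx}) (Fs : {set F}) : {set V} :=
  [set v | (inl v \in U) && [exists f in Fs, v \in Vf f]].

Definition self_contained (U : {set vtx}) (Fs : {set F}) : bool :=
  [&& [forall f in Fs, inr f \in U],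
      #|Fs| == #|adjV U Fs| &
      [forall F' : {set F}, (F' \subset Fs) ==> (#|F'| <= #|adjV U F'|)%N]].

Definition minimal_self_contained (U : {set vtx}) (Fs : {set F}) : bool :=
  [&& Fs != finset.set0, self_contained U Fs &
      [forall F' : {set F},
         ((F' != finset.set0) && (F' \proper Fs)) ==> ~~ self_contained U F']].

Definition is_matching (U : {set vtx}) (M : {set V * F}) : bool :=
  [forall e in M, [&& e.1 \in Vf e.2, inl e.1 \in U & inr e.2 \in U]] &&
  [forall e in M, forall e' in M,
     ((e.1 == e'.1) || (e.2 == e'.2)) ==> (e == e')].

Definition is_maximum_matching (U : {set vtx}) (M : {set V * F}) : bool :=
  is_matching U M &&
  [forall M' : {set V * F}, is_matching U M' ==> (#|M'| <= #|M|)%N].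

(* a (canonically chosen) maximum matching of the subgraph induced by U;
   the coarse decomposition does not depend on this choice *)
Definition maxmatch (U : {set vtx}) : {set V * F} :=
  [arg max_(M > finset.set0 | is_matching U M) #|M|].

Definition matched (M : {set V * F}) (x : vtx) : bool :=
  match x with
  | inl v => [exists f, (v, f) \in M]
  | inr f => [exists v, (v, f) \in M]
  end.

Definition inM (M : {set V * F}) (x y : vtx) : bool :=
  match x, y with
  | inl v, inr f => (v, f) \in M
  | inr f, inl v => (v, f) \in M
  | _, _ => false
  end.

Definition alt_path (U : {set vtx}) (M : {set V * F}) (u : vtx) (p : seq vtx)
  : bool :=
  [&& uniq (u :: p), all (fun x => x \in U) (u :: p), path adjB u p &
      sorted (fun a b : bool => a != b) (pairmap (inM M) u p)].

Definition is_var (x : vtx) : bool := if x is inl _ then true else false.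
Definition is_con (x : vtx) : bool := if x is inr _ then true else false.

Definition T_I (U : {set vtx}) : {set vtx} :=
  [set x in U | `[< exists u p, [&& u \in U, is_var u,
       ~~ matched (maxmatch U) u, alt_path U (maxmatch U) u p &
       last u p == x] >]].

Definition T_O (U : {set vtx}) : {set vtx} :=
  [set x in U | `[< exists u p, [&& u \in U, is_con u,
       ~~ matched (maxmatch U) u, alt_path U (maxmatch U) u p &
       last u p == x] >]].

Definition T_C (U : {set vtx}) : {set vtx} := U :\: (T_I U :|: T_O U).

Definition clusterOf (U : {set vtx}) (Fs : {set F}) : {set vtx} :=
  (inr @: Fs) :|: (inl @: adjV U Fs).

Fixpoint alg1_run (U : {set vtx}) (s : seq {set F}) : Prop :=
  match s with
  | [::] => U = finset.set0
  | Sf :: s' => minimal_self_contained U Sf /\ alg1_run (U :\: clusterOf U Sf) s'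
  end.

Fixpoint alg1_steps (U : {set vtx}) (s : seq {set F})
  : seq ({set vtx} * {set F}) :=
  match s with
  | [::] => [::]
  | Sf :: s' => (U, Sf) :: alg1_steps (U :\: clusterOf U Sf) s'
  end.

Variable W : {set V}.

Definition U0 : {set vtx} :=
  [set x | if x is inl v then v \notin W else true].

Definition TI := T_I U0.
Definition TO := T_O U0.
Definition TC := T_C U0.

Definition relIn (S : {set vtx}) : rel vtx :=
  fun x y => [&& x \in S, y \in S & adjB x y].
Definition components (S : {set vtx}) : {set {set vtx}} :=
  [set [set y in S | connect (relIn S) x y] | x in S].

(* The run s of Algorithm 1 on B_C is a parameter (the result does not
   depend on the choices made). *)
Variable s : seq {set F}.

Definition stepsC := alg1_steps TC s.

Definition clusters : {set {set vtx}} :=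
  [set C | C \in [seq clusterOf st.1 st.2 | st <- stepsC]]
  :|: components TI :|: components TO :|: [set [set inl w] | w in W].

Definition sameCl (x y : vtx) : bool :=
  [exists C in clusters, (x \in C) && (y \in C)].

(* the declustered graph D(CO(B)): x -> y iff (x -> cl(y)) is an edge *)
Definition Dedge (x y : vtx) : bool :=
  has (fun st => (y \in clusterOf st.1 st.2) &&
                 (x \in inl @: (adjV TC st.2 :\: adjV st.1 st.2))) stepsC
  || [exists f : F, (is_var x && adjB x (inr f) && sameCl (inr f) y) &&
        ((((x \in TO) || (x \in TC)) && (inr f \in TI))
         || ((x \in TO) && (inr f \in TC)))]
  || [exists w in W, exists f : F,
        [&& x == inl w, adjB x (inr f) & sameCl (inr f) y]].

(* Markov ordering graph MO(B): D(CO(B)) with F marginalized out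
   (latent projection); a directed mixed graph on V *)
Definition MO_dir (v v' : V) : Prop :=
  v != v' /\ exists p : seq F, path Dedge (inl v) (map inr p ++ [:: inl v']).

Definition MO_bi (v v' : V) : Prop :=
  v != v' /\ exists (u : F) (p q : seq F),
    path Dedge (inr u) (map inr p ++ [:: inl v]) /\
    path Dedge (inr u) (map inr q ++ [:: inl v']).

Definition VCO : {set V} :=
  [set v | (inl v \in TC) || (inl v \in TO) || (v \in W)].

End Bipartite.

Inductive ekind := Fwd | Bwd | Bi.

Section DSep.
Variables (T : finType) (dir bi : T -> T -> Prop) (S : {set T}).

Definition medge (k : ekind) (x y : T) : Prop :=
  match k with Fwd => dir x y | Bwd => dir y x | Bi => bi x y end.

Fixpoint walk_from (x : T) (st : seq (ekind * T)) : Prop :=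
  match st with
  | [::] => True
  | (k, y) :: st' => [/\ y \in S, medge k x y & walk_from y st']
  end.

Definition arrow_in (k : ekind) : bool := if k is Bwd then false else true.
Definition arrow_out (k : ekind) : bool := if k is Fwd then false else true.

(* the node x, entered by an edge of kind kin, followed by the steps st,
   is C-open: interior colliders are in C, interior non-colliders and the
   final endpoint are not in C *)
Fixpoint open_from (C : {set T}) (kin : ekind) (x : T) (st : seq (ekind * T))
  : Prop :=
  match st with
  | [::] => x \notin C
  | (k, y) :: st' =>
      (if arrow_in kin && arrow_out k then x \in C else x \notin C)
      /\ open_from C k y st'
  end.

Definition walk_open (C : {set T}) (x0 : T) (st : seq (ekind * T)) : Prop :=
  x0 \notin C /\
  match st with [::] => True | (k, y) :: st' => open_from C k y st' end.

Definition dsep (A B C : {set T}) : Prop :=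
  forall (a : T) (st : seq (ekind * T)),
    a \in A -> a \in S -> last a (map snd st) \in B -> walk_from a st ->
    ~ walk_open C a st.
End DSep.

Local Open Scope classical_set_scope.

(* standard measurable space (standard Borel space): Borel-isomorphic to a
   Borel subset of the reals (Kuratowski) *)
Definition standard_measurable (R : realType) (d : measure_display)
  (X : measurableType d) : Prop :=
  exists f : X -> R, [/\ measurable_fun setT f, injective f,
    measurable (range f) & forall A, measurable A -> measurable (f @` A)].

Section Configurations.
Variables (V : finType) (dv : V -> measure_display)
  (T : forall v, measurableType (dv v)).

Definition cfg := forall v, T v.

Definition cyl (S : {set V}) : set (set cfg) :=
  <<s [set A | exists v, v \in S /\
         exists B : set (T v), measurable B /\ A = (fun x : cfg => x v) @^-1` B] >>.

(* f is a measurable function of the coordinates x_S only *)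
Definition meas_on (S : {set V}) (dY : measure_display) (Y : measurableType dY)
  (f : cfg -> Y) : Prop :=
  forall B : set Y, measurable B -> cyl S (f @^-1` B).

Definition sigmaRV (dO : measure_display) (O : measurableType dO)
  (Z : forall v, O -> T v) (S : {set V}) : set (set O) :=
  <<s [set A | exists v, v \in S /\
         exists B : set (T v), measurable B /\ A = Z v @^-1` B] >>.
End Configurations.

Section Probability.
Variables (R : realType) (dO : measure_display) (O : measurableType dO)
  (P : probability O R).

Definition cond_prob (G : set (set O)) (E : set O) (g : O -> R) : Prop :=
  [/\ (forall B : set R, measurable B -> G (g @^-1` B)),
      P.-integrable setT (EFin \o g) &
      forall G0, G G0 -> (\int[P]_(x in G0) (g x)%:E = P (E `&` G0))%E].

Definition cond_indep (GA GB GC : set (set O)) : Prop :=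
  forall EA EB, GA EA -> GB EB ->
    exists gA gB gAB : O -> R,
      [/\ cond_prob GC EA gA, cond_prob GC EB gB,
          cond_prob GC (EA `&` EB) gAB &
          {ae P, forall x, gAB x = gA x * gB x}].
End Probability.

Section Constraints.
Variables (R : realType) (V F : finType) (W : {set V}) (Vf : F -> {set V})
  (dv : V -> measure_display) (T : forall v, measurableType (dv v))
  (dY : measure_display) (Y : measurableType dY)
  (c : F -> Y) (phi : F -> cfg T -> Y)
  (dO : measure_display) (O : measurableType dO) (P : probability O R)
  (X : forall v, O -> T v).

Definition exo_independent : Prop :=
  forall B : forall v, set (T v), (forall w, w \in W -> measurable (B w)) ->
    fine (P (\bigcap_(w in [set w | w \in W]) (X w @^-1` B w))) =
    \prod_(w in W) fine (P (X w @^-1` B w)).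

(* the exogenous configuration X_W(omega) (only the W-coordinates matter) *)
Definition XW (o : O) : cfg T := fun v => X v o.

Definition mixW (x : cfg T) (o : O) : cfg T :=
  fun v => if v \in W then X v o else x v.

Definition Xstar (h : cfg T -> cfg T) (v : V) (o : O) : T v :=
  if v \in W then X v o else h (XW o) v.

Definition is_solution (h : cfg T -> cfg T) : Prop :=
  (forall v, v \notin W -> meas_on W (fun x => h x v)) /\
  {ae P, forall o, forall f, phi f (mixW (h (XW o)) o) = c f}.

Definition VofF (SF : {set F}) : {set V} := (\bigcup_(f in SF) Vf f)%SET.

Definition solvable_wrt (SF : {set F}) (SV : {set V}) : Prop :=
  exists g : cfg T -> cfg T,
    (forall v, v \in SV -> meas_on (VofF SF :\: SV) (fun x => g x v)) /\
    {ae P, forall o, forall x : cfg T,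
       (forall v, v \in SV -> x v = g (mixW x o) v) ->
       forall f, f \in SF -> phi f (mixW x o) = c f}.

Definition uniquely_solvable_wrt (SF : {set F}) (SV : {set V}) : Prop :=
  exists g : cfg T -> cfg T,
    (forall v, v \in SV -> meas_on (VofF SF :\: SV) (fun x => g x v)) /\
    {ae P, forall o, forall x : cfg T,
       (forall v, v \in SV -> x v = g (mixW x o) v) <->
       (forall f, f \in SF -> phi f (mixW x o) = c f)}.

Definition max_uniquely_solvable (s : seq {set F}) : Prop :=
  (forall C, C \in clusters Vf W s ->
     (C :&: inl @: W == finset.set0)%SET -> (C :&: TI Vf W == finset.set0)%SET ->
     uniquely_solvable_wrt [set f | inr f \in C]%SET [set v | inl v \in C]%SET) /\
  solvable_wrt [set f | inr f \in TI Vf W]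
               [set v | (inl v \in TI Vf W) && (v \notin W)]%SET.
End Constraints.

(* Main.v *)
(* Almost surely, every endogenous variable of VCO is a measurable function of
   the other variables adjacent to its cluster (a cluster of B_C or a component
   of B_O), by unique solvability; all of these are parents in the Markov
   ordering graph, because there is no edge between T_I variables and T_C or
   T_O constraints, nor between T_O constraints and T_C variables, and T_I and
   T_O are disjoint.  The exogenous variables are independent, so the claim is
   the global Markov property of an acyclic system of deterministic equations.
   It is proved by removing an endogenous variable v of maximal rank: if v is
   in A or B, replace it by its parents outside C; if v is in C, then conditioning
   on v opens the collider at v, so its parents can be added to one of A and B
   without breaking d-separation, and weak union brings v back into C.  When
   only exogenous variables are left, d-separation means A :&: B \subset C.
   Conditional probabilities are Radon-Nikodym derivatives on sub-sigma-algebras. *)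
Require Import Defs.
From HB Require Import structures.
From mathcomp Require Import all_boot all_order all_algebra.
From mathcomp Require Import all_classical all_reals all_analysis.
From mathcomp Require Import measurable_realfun.
Set Implicit Arguments. Unset Strict Implicit.
Unset Printing Implicit Defensive.
Import Order.TTheory GRing.Theory Num.Theory.

(** * Alternating paths as a reachability relation *)

Section AlternatingPaths.
Variables (V F : finType) (Vf : F -> {set V}) (U : {set vtx V F}).
Implicit Types (M : {set V * F}) (x y u : vtx V F) (b : bool).

(* Alternating paths that start at an unmatched vertex of the side b, with
   b = true for variables: a step leaves the side b along any edge, and the
   other side along an edge of M. *)
Definition alt_step M b x y : bool :=
  [&& x \in U, y \in U & if is_var x == b then adjB Vf x y else inM M x y].

Definition alt_reach M b x : Prop := exists u,
  [/\ u \in U, is_var u = b, ~~ matched M u & connect (alt_step M b) u x].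

Lemma adjB_sym x y : adjB Vf x y = adjB Vf y x.
Proof. by case: x y => [v|f] [v'|f']. Qed.

Lemma adjB_side x y : adjB Vf x y -> is_var y = ~~ is_var x.
Proof. by case: x y => [v|f] [v'|f']. Qed.

Lemma inM_sym M x y : inM M x y = inM M y x.
Proof. by case: x y => [v|f] [v'|f']. Qed.

Lemma inM_side M x y : inM M x y -> is_var y = ~~ is_var x.
Proof. by case: x y => [v|f] [v'|f']. Qed.

(** Reversing an edge moves its start to the other side, which swaps the two rules. *)
Lemma alt_step_rev M b x y : alt_step M (~~ b) x y -> alt_step M b y x.
Proof.
rewrite /alt_step => /and3P[-> ->] /=.
case: eqP => [xb axy|/eqP xb mxy].
  by rewrite (adjB_side axy) xb negbK eqxx adjB_sym.
rewrite (inM_side mxy) inM_sym mxy.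
by case: (is_var x) b xb => [] [].
Qed.

Lemma is_matching0 : is_matching Vf U finset.set0.
Proof.
by apply/andP; split; apply/forallP => e; rewrite inE.
Qed.

Lemma maxmatch_matching : is_matching Vf U (maxmatch Vf U).
Proof. by rewrite /maxmatch; case: arg_maxnP => //; exact: is_matching0. Qed.

Lemma maxmatch_max M : is_matching Vf U M -> (#|M| <= #|maxmatch Vf U|)%N.
Proof.
by rewrite /maxmatch; case: arg_maxnP => [|M' mM' maxM'] // => [|/maxM']; first exact: is_matching0.
Qed.

Lemma matching_edge M v f : is_matching Vf U M -> (v, f) \in M ->
  [/\ v \in Vf f, inl v \in U & inr f \in U].
Proof. by move=> /andP[/forallP/(_ (v, f))/implyP e _] /e /and3P[]. Qed.

Lemma inM_adjB M x y : is_matching Vf U M -> inM M x y ->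
  [/\ adjB Vf x y, x \in U & y \in U].
Proof.
move=> mM; case: x y => [v|f] [v'|f'] //= /(matching_edge mM)[]; by split.
Qed.

Lemma inM_inj M x y z : is_matching Vf U M -> inM M x y -> inM M x z -> y = z.
Proof.
move=> /andP[_ /forallP mM].
have {}mM e e' : e \in M -> e' \in M -> (e.1 == e'.1) || (e.2 == e'.2) -> e = e'.
  move=> eM e'M ee'; apply/eqP.
  by move/implyP: (mM e) => /(_ eM) /forallP/(_ e')/implyP/(_ e'M)/implyP; exact.
case: x y z => [v|f] [v1|f1] [v2|f2] //= m1 m2.
  by have := mM _ _ m1 m2; rewrite /= eqxx => /(_ isT)[->].
by have := mM _ _ m1 m2; rewrite /= eqxx orbT => /(_ isT)[->].
Qed.

Lemma matchedP M x : reflect (exists y, inM M x y) (matched M x).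
Proof.
apply: (iffP idP); case: x => [v|f] /=.
- by move/existsP => [f vf]; exists (inr f).
- by move/existsP => [v vf]; exists (inl v).
- by case=> -[//|f] vf; apply/existsP; exists f.
- by case=> -[v|//] vf; apply/existsP; exists v.
Qed.

(** The bit [is_var x == b] stands for membership in [M] of an imaginary edge into [x]: alternation
    then forces a free edge out of side [b] and a matched one out of the other side. *)
Lemma alt_path_alt_step M b x p : all (fun x => x \in U) (x :: p) ->
  path (adjB Vf) x p ->
  path (fun a b : bool => a != b) (is_var x == b) (pairmap (inM M) x p) ->
  path (alt_step M b) x p.
Proof.
elim: p x => [//|y p IH] x /= /and3P[xU yU pU] /andP[axy ap] /andP[m mp].
apply/andP; split.
  rewrite /alt_step xU yU axy /=; move: m.
  by case: (_ == b); case: (inM M x y).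
apply: IH => //=; first by rewrite yU.
move: m mp; rewrite (adjB_side axy).
by case: (is_var x) b (inM M x y) => [] [] [].
Qed.

(** A step out of side [b] could use an edge of [M]. The last hypothesis forbids this at [x];
    further on, such an edge would lead back to the vertex just left, since partners are unique,
    against [uniq]. *)
Lemma alt_step_alt_path M b x p : is_matching Vf U M ->
  path (alt_step M b) x p -> uniq (x :: p) ->
  (is_var x = b -> forall y, inM M x y -> y \notin p) ->
  path (adjB Vf) x p /\
  path (fun a b : bool => a != b) (is_var x == b) (pairmap (inM M) x p).
Proof.
move=> mM; elim: p x => [//|y p IH] x /= /andP[sxy sp] /andP[xyp uyp] xM.
have axy : adjB Vf x y.
  by move: sxy => /and3P[_ _]; case: ifP => // _ /(inM_adjB mM)[].
have mxy : inM M x y = (is_var x != b).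
  move: sxy => /and3P[_ _]; case: eqP => // xb _; apply/negP => /(xM xb).
  by rewrite inE eqxx.
have [|ap mp] := IH y sp uyp.
  move=> yb z myz.
  have myx : inM M y x.
    by rewrite inM_sym mxy -yb (adjB_side axy); case: (is_var x).
  rewrite -(inM_inj mM myx myz); apply: contraNN xyp => xp.
  by rewrite inE xp orbT.
split; first by rewrite axy.
rewrite mxy; apply/andP; split; first by clear; case: (is_var x) b => [] [].
by move: mp; rewrite (adjB_side axy); clear; case: (is_var x) b => [] [].
Qed.

Lemma alt_reach_closed M b x y : alt_reach M b x -> alt_step M b x y -> alt_reach M b y.
Proof.
move=> [u [uU ub um ux]] xy; exists u; split=> //.
exact: connect_trans ux (connect1 xy).
Qed.

Let Mx := maxmatch Vf U.

(** Alternation alone leaves open whether the first edge is matched; it is free because the path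
    starts at an unmatched vertex. *)
Lemma alt_pathP b x : x \in U ->
  (exists u p, [&& u \in U, is_var u == b, ~~ matched Mx u,
     alt_path Vf U Mx u p & last u p == x]) <-> alt_reach Mx b x.
Proof.
move=> xU; split.
  move=> [u [p /and5P[uU /eqP ub um ap /eqP <-]]]; exists u; split=> //.
  apply/connectP; exists p => //.
  move: ap => /and4P[_ pU ap sp]; apply: alt_path_alt_step => //.
  case: p pU ap sp => [//|y p] _ _ /= ->; rewrite ub eqxx andbT.
  by case E: (inM Mx u y) => //; case/matchedP: um; exists y.
move=> [u [uU ub um /connectP[p pp xl]]].
have : path (alt_step Mx b) u p by [].
(* Reachability yields a walk; shortening it supplies distinct vertices. *)
move: xl; case/shortenP: pp => p' pp' up' _ xl _.
exists u, p'; rewrite uU ub eqxx um xl eqxx andbT /=.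
have um' y : ~~ inM Mx u y by apply/negP => uy; case/matchedP: um; exists y.
have [|ap mp] := alt_step_alt_path maxmatch_matching pp' up'.
  by move=> _ y; rewrite (negbTE (um' y)).
apply/and4P; split=> //; last by case: (p') mp => [//|y q] /= /andP[].
apply/allP => z; rewrite inE => /orP[/eqP->//|].
elim: p' u pp' {xl up' ap mp um' uU ub um} => [//|y p' IH] u /= /andP[/and3P[_ yU _] pp'].
by rewrite inE => /orP[/eqP->//|]; exact: IH pp'.
Qed.

Lemma T_IE x : x \in T_I Vf U <-> x \in U /\ alt_reach Mx true x.
Proof.
rewrite inE; split=> [/andP[xU /asboolP h]|[xU h]].
  split=> //; apply/(alt_pathP _ xU).
  by case: h => u [p h]; exists u, p; rewrite eqb_id.
rewrite xU; apply/asboolP; move/(alt_pathP _ xU): h => [u [p h]].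
by exists u, p; rewrite eqb_id in h.
Qed.

Lemma T_OE x : x \in T_O Vf U <-> x \in U /\ alt_reach Mx false x.
Proof.
have con u : is_con u = (is_var u == false) by case: u.
rewrite inE; split=> [/andP[xU /asboolP h]|[xU h]].
  split=> //; apply/(alt_pathP _ xU).
  by case: h => u [p h]; exists u, p; rewrite -con.
rewrite xU; apply/asboolP; move/(alt_pathP _ xU): h => [u [p h]].
by exists u, p; rewrite con.
Qed.

End AlternatingPaths.

(** * Augmenting paths and closure of the coarse decomposition *)

Section Augmenting.
Variables (V F : finType) (Vf : F -> {set V}) (U : {set vtx V F}).
Implicit Types (M : {set V * F}) (x y u : vtx V F) (b : bool).
Local Notation step := (alt_step Vf U).

Lemma is_matchingP M : is_matching Vf U M <->
  (forall v f, (v, f) \in M -> [&& v \in Vf f, inl v \in U & inr f \in U]) /\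
  (forall x y z, inM M x y -> inM M x z -> y = z).
Proof.
split=> [mM|[edge inj]].
  split=> [v f /(matching_edge mM)[-> ->]//|x y z]; exact: inM_inj mM.
apply/andP; split; first by apply/forallP => -[v f]; apply/implyP => /edge.
apply/forallP => -[v f]; apply/implyP => m.
apply/forallP => -[v' f']; apply/implyP => m'; apply/implyP => /= /orP[] /eqP E.
  by move: m'; rewrite -E => m'; have [->] := inj (inl v) (inr f) (inr f') m m'.
by move: m'; rewrite -E => m'; have [->] := inj (inr f) (inl v) (inl v') m m'.
Qed.

Lemma is_matching_sub M M' : M' \subset M -> is_matching Vf U M -> is_matching Vf U M'.
Proof.
move=> /fintype.subsetP sub /is_matchingP[edge inj]; apply/is_matchingP.
have inMsub x y : inM M' x y -> inM M x y by case: x y => [v|f] [v'|f'] //=; exact: sub.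
by split=> [v f /sub/edge//|x y z /inMsub xy /inMsub]; exact: inj.
Qed.

Lemma is_matching_add M v f : is_matching Vf U M ->
  v \in Vf f -> inl v \in U -> inr f \in U ->
  ~~ matched M (inl v) -> ~~ matched M (inr f) -> is_matching Vf U ((v, f) |: M).
Proof.
move=> /is_matchingP[edge inj] vf vU fU vM fM; apply/is_matchingP.
have {}vM f' : (v, f') \in M = false.
  by apply/negP => m; case/matchedP: vM; exists (inr f').
have {}fM v' : (v', f) \in M = false.
  by apply/negP => m; case/matchedP: fM; exists (inl v').
split=> [w g|].
  by rewrite !inE => /orP[/eqP[-> ->]|/edge//]; rewrite vf vU fU.
move=> [w|g] [w1|g1] [w2|g2] //=; rewrite !inE !xpair_eqE.
- move=> /orP[/andP[/eqP-> /eqP->]|m1] /orP[/andP[/eqP E /eqP E']|m2].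
  + by rewrite E'.
  + by rewrite vM in m2.
  + by rewrite E vM in m1.
  + exact: (inj (inl w) (inr g1) (inr g2) m1 m2).
- move=> /orP[/andP[/eqP-> /eqP->]|m1] /orP[/andP[/eqP E /eqP E']|m2].
  + by rewrite E.
  + by rewrite fM in m2.
  + by rewrite E' fM in m1.
  + exact: (inj (inr g) (inl w1) (inl w2) m1 m2).
Qed.

(* Along an augmenting path, exchanging its first matched edge with the edge
   before it yields a shorter augmenting path for a matching of the same size. *)
Lemma no_augmenting_path n M v p : (size p < n)%N -> is_matching Vf U M ->
  (forall M', is_matching Vf U M' -> (#|M'| <= #|M|)%N) ->
  path (step M true) (inl v) p -> uniq (inl v :: p) ->
  ~~ matched M (inl v) -> ~~ is_var (last (inl v) p) ->
  matched M (last (inl v) p).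
Proof.
elim: n M v p => // n IH M v p pn mM maxM; case: p pn => [//|[//|f] p] /=.
  by move=> ? _ /andP[/and3P[_ _ /=]].
move=> pn /andP[/and3P[vU fU /= vf] pp] /and3P[vp fp up] vM0 lc.
have vM : ~~ matched M (inl v) := vM0.
(* A single edge between two unmatched vertices could be added to [M]. *)
case: p pn pp vp fp up lc => [_ _ _ _ _ _|y p pn /= /andP[/and3P[_ yU /= fy] pp]].
  apply: contraT => fM.
  have := maxM _ (is_matching_add mM vf vU fU vM fM).
  rewrite cardsU1; case: (boolP ((v, f) \in M)) => [m _|_]; last by rewrite add1n ltnn.
  by case/matchedP: fM; exists (inl v).
case: y pn yU fy pp => [v1|//] pn v1U v1f pp vp fp /andP[v1p up] lc.
have v1f' : (v1, f) \in M by [].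
have vM' g : (v, g) \in M = false.
  by apply/negP => m; case/matchedP: vM; exists (inr g).
(* The exchange frees [v1], the start of the rest of the path; that rest avoids [f], so its matched
   edges lie in [M'] too. *)
pose M0 := M :\ (v1, f); pose M' := (v, f) |: M0.
have mM0 : is_matching Vf U M0 by apply: is_matching_sub mM; exact: finset.subD1set.
have mM' : is_matching Vf U M'.
  apply: is_matching_add => //.
    by apply/matchedP => -[[//|g]] /=; rewrite !inE vM' andbF.
  apply/matchedP => -[[w|//]] /=; rewrite !inE => /andP[ne m].
  have [E] := inM_inj mM (x := inr f) (y := inl w) (z := inl v1) m v1f'.
  by rewrite E eqxx in ne.
have cM' : #|M'| = #|M|.
  by rewrite cardsU1 !inE vM' andbF (cardsD1 (v1, f) M) v1f'.
have inM'E x z : inM M x z -> inr f != x -> inr f != z -> inM M' x z.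
  case: x z => [w|g] [w'|g'] //= m; rewrite !inE m andbT.
    move=> _ fg; apply/orP; right; apply: contraNN fg => /eqP[_ ->]; exact: eqxx.
  move=> fg _; apply/orP; right; apply: contraNN fg => /eqP[_ ->]; exact: eqxx.
have pp' : path (step M' true) (inl v1) p.
  apply: (@sub_in_path _ (fun x => inr f != x) (step M true)) pp.
    move=> x z fx fz /and3P[xU zU xz]; rewrite /alt_step xU zU /=.
    by move: xz; case: ifP => // _ xz; exact: inM'E.
  apply/allP => x xp; apply: contraNneq fp => ->; exact: xp.
have lM' : matched M' (last (inl v1) p).
  apply: (IH M' v1 p) => //.
  - by rewrite -ltnS; apply: ltn_trans pn.
  - by move=> N /maxM; rewrite cM'.
  - by rewrite /= v1p.
  - apply/matchedP => -[[//|g]] /=; rewrite !inE => /orP[/eqP[E _]|/andP[ne m]].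
      by rewrite E vM' in v1f'.
    have [E] := inM_inj mM (x := inl v1) (y := inr g) (z := inr f) m v1f'.
    by rewrite E eqxx in ne.
(* The end is a constraint other than [f], so the edge of [M'] covering it is not the new one and
   belongs to [M]. *)
have lf : inr f != last (inl v1) p.
  by apply: contraNneq fp => ->; exact: mem_last.
case: (last (inl v1) p) lc lf lM' => [//|g] _ fg /matchedP[[w|//] /=].
rewrite !inE => /orP[/eqP[_ E]|/andP[_ m]]; first by rewrite E eqxx in fg.
by apply/existsP; exists w.
Qed.

Let Mx := maxmatch Vf U.

Lemma no_augmenting_reach u v : is_var u -> ~~ is_var v -> ~~ matched Mx u ->
  connect (step Mx true) u v -> matched Mx v.
Proof.
case: u => // w _ vv uM /connectP[p pp vl]; rewrite vl; move: vl.
case/shortenP: pp => p' pp' up' _ vl.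
apply: (@no_augmenting_path (size p').+1) => //; last by rewrite -vl.
- exact: maxmatch_matching.
- exact: maxmatch_max.
Qed.

(** A path from an unmatched constraint, read backwards, continues one from an unmatched variable;
    together they would reach an unmatched constraint, against [no_augmenting_reach]. *)
Lemma T_I_T_O_disjoint x : x \in T_I Vf U -> x \notin T_O Vf U.
Proof.
move=> /T_IE[_ [u [uU uv uM ux]]]; apply/negP => /T_OE[_ [f [fU fv fM fx]]].
have : connect (step Mx true) x f.
  move: fx => /connectP[p pp ->] {ux fU fv fM}; elim: p f pp => [//|y p IH] f /=.
  move=> /andP[fy yp]; apply: connect_trans (IH _ yp) (connect1 _).
  exact: (@alt_step_rev _ _ _ _ _ true).
move=> xf; case/negP: fM; apply: no_augmenting_reach (connect_trans ux xf) => //.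
by rewrite fv.
Qed.

(** A path from an unmatched variable may leave a variable by any edge; the next lemma is the mirror
    image for constraints. *)
Lemma T_I_adjacent v f : inl v \in T_I Vf U -> inr f \in U -> v \in Vf f ->
  inr f \in T_I Vf U.
Proof.
move=> /T_IE[vU rv] fU vf; apply/T_IE; split=> //.
by apply: alt_reach_closed rv _; rewrite /alt_step vU fU.
Qed.

Lemma T_O_adjacent v f : inr f \in T_O Vf U -> inl v \in U -> v \in Vf f ->
  inl v \in T_O Vf U.
Proof.
move=> /T_OE[fU rf] vU vf; apply/T_OE; split=> //.
by apply: alt_reach_closed rf _; rewrite /alt_step vU fU.
Qed.

End Augmenting.

(** * Runs of the causal ordering algorithm *)

Section Algorithm1.
Variables (V F : finType) (Vf : F -> {set V}).
Implicit Types (U : {set vtx V F}) (s : seq {set F}) (x y : vtx V F).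

Lemma inr_clusterOf U (Fs : {set F}) f : (inr f \in clusterOf Vf U Fs) = (f \in Fs).
Proof.
rewrite inE (finset.mem_imset _ _ inr_inj).
by rewrite [X in _ || X](_ : _ = false) ?orbF//; apply/imsetP => -[].
Qed.

Lemma inl_clusterOf U (Fs : {set F}) v :
  (inl v \in clusterOf Vf U Fs) = (v \in adjV Vf U Fs).
Proof.
rewrite inE (finset.mem_imset _ _ inl_inj).
by rewrite [X in X || _](_ : _ = false)//; apply/imsetP => -[].
Qed.

Lemma adjVP U (Fs : {set F}) v : reflect (inl v \in U /\ exists2 f, f \in Fs & v \in Vf f)
  (v \in adjV Vf U Fs).
Proof.
rewrite inE; apply: (iffP andP) => -[vU]; first by move/exists_inP => [f]; split=> //; exists f.
by case=> f ? ?; split=> //; apply/exists_inP; exists f.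
Qed.

Lemma clusterOf_sub U (Fs : {set F}) : self_contained Vf U Fs ->
  clusterOf Vf U Fs \subset U.
Proof.
move=> /and3P[/forall_inP FsU _ _]; apply/fintype.subsetP => -[v|f].
  by rewrite inl_clusterOf => /adjVP[].
by rewrite inr_clusterOf => /FsU.
Qed.

Lemma alg1_steps_sub U s st : alg1_run Vf U s -> st \in alg1_steps Vf U s ->
  st.1 \subset U /\ self_contained Vf st.1 st.2.
Proof.
elim: s U => [//|Fs s IH] U /= [/and3P[_ sc _] run].
rewrite inE => /orP[/eqP->//|/(IH _ run)[sub ?]]; split=> //.
exact: fintype.subset_trans sub (finset.subsetDl _ _).
Qed.

Lemma alg1_steps_cover U s x : alg1_run Vf U s -> x \in U ->
  exists2 st, st \in alg1_steps Vf U s & x \in clusterOf Vf st.1 st.2.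
Proof.
elim: s U => [|Fs s IH] U /=; first by move=> ->; rewrite inE.
move=> [_ run] xU; have [xC|xC] := boolP (x \in clusterOf Vf U Fs).
  by exists (U, Fs) => //; rewrite inE eqxx.
have [|st sts xst] := IH _ run; first by rewrite inE xC.
by exists st => //; rewrite inE sts orbT.
Qed.

(** [x] was removed before the step [st], while [y] is still present there. The position of the
    removing step thus ranks the vertices compatibly with the edges of the ordering graph. *)
Lemma alg1_steps_order U s st x y : alg1_run Vf U s -> st \in alg1_steps Vf U s ->
  y \in st.1 -> x \in U -> x \notin st.1 ->
  (find (fun st => x \in clusterOf Vf st.1 st.2) (alg1_steps Vf U s) <
   find (fun st => y \in clusterOf Vf st.1 st.2) (alg1_steps Vf U s))%N.
Proof.
elim: s U => [//|Fs s IH] U /= [_ run].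
rewrite inE => /orP[/eqP->/= _ ->//|sts] yst xU xst.
have [/fintype.subsetP/(_ y yst) yU' _] := alg1_steps_sub run sts.
move: yU'; rewrite inE => /andP[/negbTE-> _].
case: ifPn => // xC; rewrite ltnS; apply: IH => //.
by rewrite inE xC.
Qed.

End Algorithm1.

(** * Outside neighbours of a cluster are parents *)

Section Clusters.
Variables (V F : finType) (Vf : F -> {set V}) (W : {set V}) (s : seq {set F}).
Hypothesis run : alg1_run Vf (TC Vf W) s.

(** The successor puts [T_C] above [T_O], whose variables have rank 0 and can be parents of [T_C]
    variables. Exogenous and [T_I] variables get 0 by default. *)
Definition cluster_rank (v : V) : nat :=
  if inl v \in TC Vf W then
    (find (fun st => inl v \in clusterOf Vf st.1 st.2) (stepsC Vf W s)).+1
  else 0%N.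

Lemma T_O_sub (U : {set vtx V F}) : T_O Vf U \subset U.
Proof. by apply/fintype.subsetP => x; rewrite inE => /andP[]. Qed.

Lemma TC_sub : TC Vf W \subset U0 F W.
Proof. exact: finset.subsetDl. Qed.

Lemma U0_disjointW (C : {set vtx V F}) : C \subset U0 F W ->
  C :&: inl @: W == finset.set0.
Proof.
move=> /fintype.subsetP CU; rewrite -finset.subset0; apply/fintype.subsetP => x.
rewrite inE => /andP[/CU xU /imsetP[w wW xw]].
by move: xU; rewrite xw inE wW.
Qed.

Lemma TC_notin_TI x : x \in TC Vf W -> x \notin TI Vf W.
Proof. by move=> /finset.setDP[_]; rewrite inE => /norP[]. Qed.

Lemma sameClP (C : {set vtx V F}) x y : C \in clusters Vf W s ->
  x \in C -> y \in C -> sameCl Vf W s x y.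
Proof. by move=> Cc xC yC; apply/existsP; exists C; rewrite Cc xC yC. Qed.

Lemma MO_dir_edge x v : x != v -> Dedge Vf W s (inl x) (inl v) -> MO_dir Vf W s x v.
Proof. by move=> xv e; split=> //; exists [::]; rewrite /= e. Qed.

Lemma Dedge_exogenous (C : {set vtx V F}) f w y : C \in clusters Vf W s ->
  inr f \in C -> y \in C -> w \in W -> w \in Vf f -> Dedge Vf W s (inl w) y.
Proof.
move=> Cc fC yC wW wf; apply/orP; right; apply/exists_inP; exists w => //.
by apply/existsP; exists f; rewrite eqxx /= wf (sameClP Cc).
Qed.

(** Prepares the use of unique solvability w.r.t. [C]: the variables on which [v] then depends are
    parents of [v], and ranks exclude cycles among the endogenous ones. *)
Lemma endogenous_cluster v : v \in VCO Vf W -> v \notin W ->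
  exists C : {set vtx V F}, [/\ C \in clusters Vf W s, C :&: inl @: W == finset.set0,
    C :&: TI Vf W == finset.set0, inl v \in C &
    forall f x, inr f \in C -> x \in Vf f -> inl x \notin C ->
      [/\ x \in VCO Vf W, MO_dir Vf W s x v &
          (x \in W) || (cluster_rank x < cluster_rank v)%N]].
Proof.
have exo C f x u : C \in clusters Vf W s -> inr f \in C -> inl u \in C ->
    inl x \notin C -> x \in W -> x \in Vf f -> [/\ x \in VCO Vf W, MO_dir Vf W s x u &
          (x \in W) || (cluster_rank x < cluster_rank u)%N].
  move=> Cc fC uC xC xW xf; split; [by rewrite inE xW orbT| |by rewrite xW].
  apply: MO_dir_edge; first by apply: contraNneq xC => ->.
  exact: (Dedge_exogenous Cc fC uC xW xf).
rewrite inE => /orP[/orP[vTC|vTO]|->//] vW.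
- have [st sts vst] := alg1_steps_cover run vTC.
  have [sub sc] := alg1_steps_sub run sts.
  pose C := clusterOf Vf st.1 st.2.
  have Cst : C \subset st.1 by exact: clusterOf_sub.
  have CTC : C \subset TC Vf W by exact: fintype.subset_trans sub.
  have Cc : C \in clusters Vf W s.
    apply/finset.setUP; left; apply/finset.setUP; left; apply/finset.setUP; left.
    by rewrite inE; apply/mapP; exists st.
  exists C; split => //.
  + by apply: U0_disjointW; exact: fintype.subset_trans TC_sub.
  + rewrite -finset.subset0; apply/fintype.subsetP => x; rewrite inE => /andP[xC].
    by rewrite (negbTE (TC_notin_TI (fintype.subsetP CTC _ xC))).
  move=> f x fC xf xC.
  have [xW|xW] := boolP (x \in W); first by have := exo C f x v Cc fC vst xC xW xf; rewrite xW.
  have fTC := fintype.subsetP CTC _ fC.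
  have fU0 := fintype.subsetP TC_sub _ fTC.
  have xU0 : inl x \in U0 F W by rewrite inE.
  have xTI : inl x \notin TI Vf W.
    apply: contraNN (TC_notin_TI fTC) => xTI; exact: T_I_adjacent xf.
  have fst : f \in st.2 by move: fC; rewrite inr_clusterOf.
  have xv : x != v by apply: contraNneq xC => ->.
  have [xTO|xTO] := boolP (inl x \in TO Vf W).
    split; first by rewrite inE xTO orbT.
      apply: MO_dir_edge => //; apply/orP; left; apply/orP; right.
      by apply/existsP; exists f; rewrite /= xf (sameClP Cc)//= xTO fTC orbT.
    rewrite /cluster_rank vTC ifF ?orbT//; apply/negP.
    by rewrite inE inE xTO orbT.
  have xTC : inl x \in TC Vf W.
    by apply/finset.setDP; split=> //; rewrite finset.in_setU negb_or xTI.
  (* The cluster takes every variable adjacent to [st.2] that is still present, so [x] was removed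
     earlier. *)
  have xst : inl x \notin st.1.
    by apply: contraNN xC => xst; rewrite inl_clusterOf; apply/adjVP; split=> //; exists f.
  split; first by rewrite inE xTC.
    apply: MO_dir_edge => //; apply/orP; left; apply/orP; left.
    apply/hasP; exists st => //; apply/andP; split=> //.
    apply: imset_f; rewrite inE; apply/andP; split.
      by move: xC; rewrite inl_clusterOf.
    by apply/adjVP; split=> //; exists f.
  rewrite /cluster_rank vTC xTC ltnS; apply/orP; right.
  by apply: alg1_steps_order sts _ xTC xst => //; exact: (fintype.subsetP Cst).
- pose C := [set y in TO Vf W | connect (relIn Vf (TO Vf W)) (inl v) y].
  have CTO : C \subset TO Vf W by apply/fintype.subsetP => x; rewrite inE => /andP[].
  have vC : inl v \in C by rewrite inE vTO connect0.
  have Cc : C \in clusters Vf W s.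
    apply/finset.setUP; left; apply/finset.setUP; right.
    by apply/imsetP; exists (inl v).
  exists C; split => //.
  + by apply: U0_disjointW; exact: fintype.subset_trans (T_O_sub _).
  + rewrite -finset.subset0; apply/fintype.subsetP => x.
    rewrite inE => /andP[/(fintype.subsetP CTO) xTO xTI].
    by case/negP: (T_I_T_O_disjoint xTI).
  move=> f x fC xf xC.
  have [xW|xW] := boolP (x \in W); first by have := exo C f x v Cc fC vC xC xW xf; rewrite xW.
  have fTO := fintype.subsetP CTO _ fC.
  (* Endogenous neighbours of [T_O] constraints lie in [T_O], hence here in the component of [v]: no
     such [x] is left. *)
  have xTO : inl x \in TO Vf W by apply: T_O_adjacent xf => //; rewrite inE.
  case/negP: xC; move: fC; rewrite inE => /andP[_ vf].
  rewrite inE xTO /=.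
  by apply: connect_trans vf (connect1 _); rewrite /relIn fTO xTO.
Qed.

End Clusters.

Local Open Scope ring_scope.
Local Open Scope classical_set_scope.

(** * Measures and integrals on a sub-sigma-algebra *)

Section Subalgebra.
Context (R : realType) (d : measure_display) (O : measurableType d).
Variables (gen : set (set O)) (genm : gen `<=` measurable).
Local Notation OG := (g_sigma_algebraType gen).

Lemma sub_generated_measurable : <<s gen >> `<=` measurable.
Proof. exact: smallest_sub (@sigma_algebra_measurable _ O) genm. Qed.

(** [nu] retyped on the sigma-algebra generated by [gen]; the inclusion is an argument because the
    measure structure attached below rests on it. *)
Definition submeasure (_ : gen `<=` measurable)
  (nu : {finite_measure set O -> \bar R}) : set OG -> \bar R := nu.

Section submeasure_instances.
Variable nu : {finite_measure set O -> \bar R}.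
Local Notation nuG := (submeasure genm nu).

Let nuG0 : nuG set0 = 0%E. Proof. exact: measure0. Qed.
Let nuG_ge0 A : (0 <= nuG A)%E. Proof. exact: measure_ge0. Qed.
Let nuG_sigma_additive : semi_sigma_additive nuG.
Proof.
move=> F mF tF mU; apply: (@measure_semi_sigma_additive _ _ _ nu F) => //.
  by move=> n; exact: sub_generated_measurable (mF n).
exact: sub_generated_measurable mU.
Qed.
HB.instance Definition _ :=
  isMeasure.Build _ _ _ nuG nuG0 nuG_ge0 nuG_sigma_additive.

Let nuG_fin : fin_num_fun nuG.
Proof.
move=> A mA; apply: (fin_num_measure nu).
exact: sub_generated_measurable mA.
Qed.
HB.instance Definition _ := Measure_isFinite.Build _ _ _ nuG nuG_fin.
End submeasure_instances.

Lemma measurable_fun_sub d' (Y : measurableType d') (f : O -> Y) :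
  @measurable_fun _ _ OG _ setT f -> measurable_fun setT f.
Proof. by move=> mf _ B mB; exact: sub_generated_measurable (mf measurableT B mB). Qed.

(** The retyped measure is the image of [nu] under the identity from [O] to [OG], so this is a
    change of variables. *)
Lemma ge0_integral_submeasure (nu : {finite_measure set O -> \bar R})
    (f : O -> \bar R) (G : set O) :
  @measurable_fun _ _ OG _ setT f -> (forall x, 0 <= f x)%E ->
  <<s gen >> G ->
  (\int[submeasure genm nu]_(x in G) f x = \int[nu]_(x in G) f x)%E.
Proof.
move=> mf f0 sG.
have mid : @measurable_fun _ _ O OG setT id.
  by move=> _ B mB; rewrite setTI; exact: sub_generated_measurable mB.
by rewrite (@ge0_integral_pushforward _ _ O OG R id mid nu G f)//;
  exact: measurable_funTS.
Qed.

End Subalgebra.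

Lemma ge0_integral_mrestr (R : realType) (d : measure_display)
    (O : measurableType d) (mu : {measure set O -> \bar R}) (E G : set O)
    (mE : measurable E) (f : O -> \bar R) :
  measurable_fun setT f -> (forall x, 0 <= f x)%E -> measurable G ->
  (\int[mrestr mu mE]_(x in G) f x = \int[mu]_(x in G `&` E) f x)%E.
Proof.
move=> mf f0 mG.
rewrite (@ge0_negligible_integral _ _ _ (mrestr mu mE) G (~` E))//.
- rewrite setDE setCK; apply: eq_measure_integral => A mA AGE.
  by rewrite /= /mrestr setIidl//; apply: subset_trans AGE _; exact: subIsetr.
- exact: measurableC.
- exact: measurable_funTS.
- by rewrite /= /mrestr setICl measure0.
Qed.

(** * Conditional probability: existence and pull-out *)

Section ConditionalProbability.
Context (R : realType) (d : measure_display) (O : measurableType d)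
  (P : probability O R).
Variables (gen : set (set O)) (genm : gen `<=` measurable).
Local Notation OG := (g_sigma_algebraType gen).

(* The last clause is the pull-out rule for f measurable with respect to gen. *)
Lemma conditional_probability_exists (E : set O) : measurable E ->
  exists g : O -> R, [/\ forall x, 0 <= g x,
    @measurable_fun _ _ OG _ setT g,
    forall G, <<s gen >> G -> (\int[P]_(x in G) (g x)%:E = P (E `&` G))%E &
    forall (f : O -> R) G, (forall x, 0 <= f x) ->
      @measurable_fun _ _ OG _ setT f -> <<s gen >> G ->
      (\int[P]_(x in G) (f x * g x)%:E = \int[P]_(x in G `&` E) (f x)%:E)%E].
Proof.
move=> mE.
pose mu : {finite_measure set OG -> \bar R} := submeasure genm P.
pose nu : {finite_measure set OG -> \bar R} := submeasure genm (mrestr P mE).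
have numu : nu `<< mu.
  apply/null_content_dominatesP => A mA; rewrite /mu /nu /= /submeasure /mrestr => A0.
  have mA' : measurable (A : set O) by exact: sub_generated_measurable mA.
  apply: (subset_measure0 _ mA' _ A0); last exact: subIsetl.
  exact: measurableI.
pose k : OG -> \bar R := @Radon_Nikodym_SigmaFinite.f _ OG R nu mu.
have k0 x : (0 <= k x)%E := Radon_Nikodym_SigmaFinite.f_ge0 numu x.
have kf x : k x = (fine (k x))%:E.
  by rewrite fineK// (Radon_Nikodym_SigmaFinite.f_fin_num numu).
have mk : @measurable_fun _ _ OG _ setT k.
  exact: measurable_int (Radon_Nikodym_SigmaFinite.f_integrable numu).
(* The derivative is finite at every point, so [fine] loses nothing. *)
exists (fun x => fine (k x)); split.
- by move=> x; exact: fine_ge0.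
- exact: measurableT_comp mk.
- move=> G sG; under eq_integral do rewrite -kf.
  rewrite -(@ge0_integral_submeasure _ _ _ _ genm P k)//.
  rewrite -(Radon_Nikodym_SigmaFinite.f_integral numu)//.
  by rewrite /nu /submeasure /mrestr setIC.
- move=> f G f0 mf sG.
  have mfE : @measurable_fun _ _ OG _ setT (EFin \o f) by exact/measurable_EFinP.
  under eq_integral do rewrite EFinM -kf.
  rewrite -(@ge0_integral_submeasure _ _ _ _ genm P
    (fun x => ((f x)%:E * k x)%E))//; first last.
  + by move=> x; rewrite mule_ge0// lee_fin.
  + exact: emeasurable_funM.
  (* Integrating [f] against the density [k] is integrating [f] against [nu], which is [P]
     restricted to [E]. *)
  rewrite (@Radon_Nikodym_SigmaFinite.change_of_variables _ OG R nu mu numu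
    (fun x => (f x)%:E))//; last exact: measurable_funTS.
  rewrite (@ge0_integral_submeasure _ _ _ _ genm _ (EFin \o f))//.
  rewrite ge0_integral_mrestr//.
  + exact: (measurable_fun_sub genm).
  + exact: sub_generated_measurable sG.
Qed.

End ConditionalProbability.

Section ConditionalProbabilityUnique.
Context (R : realType) (d : measure_display) (O : measurableType d)
  (P : probability O R).
Variables (gen : set (set O)) (genm : gen `<=` measurable).
Local Notation OG := (g_sigma_algebraType gen).

(** The rule passes from the version of [conditional_probability_exists] to any version [g], since
    equal integrals over the sub-sigma-algebra force almost everywhere equality. *)
Lemma conditional_probability_pullout (E : set O) (g f : O -> R) (G : set O) :
  measurable E -> (forall x, 0 <= g x) -> @measurable_fun _ _ OG _ setT g ->
  (forall G, <<s gen >> G -> (\int[P]_(x in G) (g x)%:E = P (E `&` G))%E) ->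
  (forall x, 0 <= f x) -> @measurable_fun _ _ OG _ setT f -> <<s gen >> G ->
  (\int[P]_(x in G) (f x * g x)%:E = \int[P]_(x in G `&` E) (f x)%:E)%E.
Proof.
move=> mE g0 mg gE f0 mf sG.
have [k [k0 mk kE kpull]] := conditional_probability_exists P genm mE.
rewrite -kpull//.
pose mu : {finite_measure set OG -> \bar R} := submeasure genm P.
have mg' : @measurable_fun _ _ OG _ setT (EFin \o g) by exact/measurable_EFinP.
have mk' : @measurable_fun _ _ OG _ setT (EFin \o k) by exact/measurable_EFinP.
have gi : mu.-integrable setT (EFin \o g : OG -> \bar R).
  apply/integrableP; split=> //.
  under eq_integral do rewrite gee0_abs ?lee_fin//.
  rewrite (@ge0_integral_submeasure _ _ _ _ genm P (EFin \o g))//; last first.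
    exact: (@measurableT _ OG).
  rewrite /= gE; last exact: (@measurableT _ OG).
  rewrite setIT; exact: (le_lt_trans (probability_le1 P mE)) (ltry _).
have : ae_eq mu setT (EFin \o g) (EFin \o k).
  apply: integral_ae_eq => //= F _ sF.
  rewrite (@ge0_integral_submeasure _ _ _ _ genm P (EFin \o g))//.
  rewrite (@ge0_integral_submeasure _ _ _ _ genm P (EFin \o k))//.
  by rewrite /= gE// kE.
case=> N [sN N0 subN].
have mG := sub_generated_measurable genm sG.
have mfg h : @measurable_fun _ _ OG _ setT h ->
    measurable_fun G (fun x => (f x * h x)%:E).
  move=> mh; apply/measurable_funTS/measurable_EFinP.
  by apply: measurable_funM; exact: (measurable_fun_sub genm).
apply: ge0_ae_eq_integral => //.
- exact: mfg.
- exact: mfg.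
- by move=> x _; rewrite lee_fin mulr_ge0.
- by move=> x _; rewrite lee_fin mulr_ge0.
- exists N; split => //.
    exact: sub_generated_measurable genm _ sN.
  move=> x /= nx; apply: subN => /= gk; apply: nx => Gx.
  by have [->] := gk Logic.I.
Qed.

End ConditionalProbabilityUnique.

(** * Equality of measures on a pi-system *)

Section Pi.
Context (R : realType) (d : measure_display) (O : measurableType d).

(** Both sides are measures of [G], so the sets of agreement form a Dynkin system; finiteness of
    [nu] permits the complement step. *)
Lemma integral_eq_measure_pi (mu nu : {finite_measure set O -> \bar R})
    (H : set (set O)) (g : O -> R) :
  H `<=` measurable -> setI_closed H -> H setT ->
  (forall x, 0 <= g x) -> measurable_fun setT g ->
  (forall G, H G -> (\int[mu]_(x in G) (g x)%:E = nu G)%E) ->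
  forall G, <<s H >> G -> (\int[mu]_(x in G) (g x)%:E = nu G)%E.
Proof.
move=> Hm HI HT g0 mg HE.
have sHm : <<s H >> `<=` measurable := sub_generated_measurable Hm.
have mg' D : measurable_fun D (EFin \o g).
  exact/measurable_funTS/measurable_EFinP.
apply: (@dynkin_induction _ (g_sigma_algebraType H) H) => //.
- exact: HE.
- move=> S /sHm mS IH.
  have finS : nu S \is a fin_num by exact: fin_num_measure.
  suff E : (\int[mu]_(x in ~` S) (g x)%:E + nu S = nu (~` S) + nu S)%E.
    by rewrite -[LHS](addeK _ finS) E addeK.
  rewrite -[in LHS]IH -ge0_integral_setU//; first last.
  + by rewrite disj_set_sym; exact/disj_setPCl.
  + by move=> x _; rewrite lee_fin.
  + exact: measurableC.
  rewrite setvU HE//.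
  by rewrite -measureU// ?setvU// ?setICl//; exact: measurableC.
- move=> F mF tF IH.
  have mF' n : d.-measurable (F n) by apply: sHm; exact: mF.
  rewrite ge0_integral_bigcup//; last first.
    by move=> x _; rewrite lee_fin.
  rewrite measure_bigcup//; transitivity (\sum_(0 <= n <oo) nu (F n))%E.
    by apply: eq_eseriesr => n _; exact: IH.
  by apply: eq_eseriesl => n; rewrite in_setT.
Qed.

End Pi.

(** * Sigma-algebras generated by families of variables *)

Section SigmaRV.
Context (V : finType) (dv : V -> measure_display)
  (T : forall v, measurableType (dv v))
  (dO : measure_display) (O : measurableType dO) (Z : forall v, O -> T v).
Hypothesis mZ : forall v, measurable_fun setT (Z v).
Local Notation sg S := (sigmaRV Z S).

(** The generators of [sigmaRV], named so that [g_sigma_algebraType] makes a measurable type of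
    them. *)
Definition sigmaRV_gen (S : {set V}) : set (set O) :=
  [set A | exists v, v \in S /\
         exists B : set (T v), measurable B /\ A = Z v @^-1` B].

Lemma sigmaRV_gen_measurable S : sigmaRV_gen S `<=` measurable.
Proof.
by move=> _ [v [_ [B [mB ->]]]]; rewrite -[_ @^-1` _]setTI; exact: mZ.
Qed.

Lemma sigmaRV_measurable S : sg S `<=` measurable.
Proof. exact: sub_generated_measurable (@sigmaRV_gen_measurable S). Qed.

Lemma sigmaRV_sub (S S' : {set V}) : (S \subset S')%SET -> sg S `<=` sg S'.
Proof.
move=> /fintype.subsetP SS'; apply: smallest_sub; first exact: smallest_sigma_algebra.
move=> _ [v [vS [B [mB ->]]]]; apply: sub_sigma_algebra.
by exists v; split; [exact: SS'|exists B].
Qed.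

Local Notation OS S := (g_sigma_algebraType (sigmaRV_gen S)).

Lemma sigmaRVT S : sg S setT. Proof. exact: (@measurableT _ (OS S)). Qed.
Lemma sigmaRVI S A B : sg S A -> sg S B -> sg S (A `&` B).
Proof. exact: (@measurableI _ (OS S)). Qed.

(** A pi-system generating the joint sigma-algebra, on which equalities of measures are tested. *)
Definition rectangles (A B : {set V}) : set (set O) :=
  [set E | exists EA EB, [/\ sg A EA, sg B EB & E = EA `&` EB]].

Lemma rectangles_measurable A B : rectangles A B `<=` measurable.
Proof.
move=> _ [EA [EB [sA sB ->]]].
by apply: measurableI; [exact: sigmaRV_measurable sA|exact: sigmaRV_measurable sB].
Qed.

Lemma rectanglesI A B : setI_closed (rectangles A B).
Proof.
move=> _ _ [EA [EB [sA sB ->]]] [FA [FB [tA tB ->]]].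
exists (EA `&` FA), (EB `&` FB); split; [exact: sigmaRVI|exact: sigmaRVI|].
by rewrite setIACA.
Qed.

Lemma rectanglesT A B : rectangles A B setT.
Proof.
by exists setT, setT; split; [exact: sigmaRVT|exact: sigmaRVT|rewrite setIT].
Qed.

Lemma sigmaRV_rectangles (A B : {set V}) : sg (A :|: B)%SET `<=` <<s rectangles A B >>.
Proof.
apply: smallest_sub; first exact: smallest_sigma_algebra.
move=> _ [v [vAB [C [mC ->]]]]; apply: sub_sigma_algebra.
move: vAB; rewrite inE => /orP[vA|vB].
- exists (Z v @^-1` C), setT; split; [|exact: sigmaRVT|by rewrite setIT].
  by apply: sub_sigma_algebra; exists v; split=> //; exists C.
- exists setT, (Z v @^-1` C); split; [exact: sigmaRVT| |by rewrite setTI].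
  by apply: sub_sigma_algebra; exists v; split=> //; exists C.
Qed.

Lemma sigmaRV_comp (D : {set V}) (K : set (cfg T)) :
  cyl D K -> sg D ((fun o => Z^~ o) @^-1` K).
Proof.
suff /(_ K) : cyl D `<=` [set K | sg D ((fun o => Z^~ o) @^-1` K)] by [].
apply: smallest_sub.
  split => /=.
  - by rewrite preimage_set0; exact: (@measurable0 _ (OS D)).
  - move=> A sA; rewrite setTD preimage_setC.
    exact: (@measurableC _ (OS D) _ sA).
  - move=> F sF; rewrite preimage_bigcup.
    exact: (@bigcupT_measurable _ (OS D) _ sF).
move=> _ [v [vD [B [mB ->]]]]; apply: sub_sigma_algebra.
by exists v; split => //; exists B.
Qed.

(** Outside [N] an event about [Z v] is an event about [g], which the coordinates in [S] express;
    the events with such a counterpart form a sigma-algebra. *)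
Lemma sigmaRV_determined (D S : {set V}) (v : V) (g : cfg T -> T v) (N : set O) :
  (D \subset S)%SET -> meas_on D g ->
  (forall o, ~ N o -> Z v o = g (Z^~ o)) ->
  forall E, sg (v |: S)%SET E ->
  exists E', sg S E' /\ forall o, ~ N o -> (E o <-> E' o).
Proof.
move=> DS mg ZE.
suff H : sg (v |: S)%SET `<=` [set E | exists E', sg S E' /\
    forall o, ~ N o -> (E o <-> E' o)] by move=> E /H.
apply: smallest_sub.
  split => /=.
  - by exists set0; split => //; exact: (@measurable0 _ (OS S)).
  - move=> A [A' [sA' AA']]; exists (~` A'); split.
      exact: (@measurableC _ (OS S) _ sA').
    move=> o /AA' AA'o; split=> [[_ nA] /AA'o//|nA].
    by split=> // /AA'o.
  - move=> F /choice[F' FF']; exists (\bigcup_n F' n); split.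
      by apply: (@bigcupT_measurable _ (OS S)) => n; exact: (FF' n).1.
    by move=> o No; split=> -[n _ Fn]; exists n => //; apply/((FF' n).2 _ No).
move=> _ [u [uS [B [mB ->]]]].
have [uSv|uNS] := boolP (u \in S).
  exists (Z u @^-1` B); split => //.
  by apply: sub_sigma_algebra; exists u; split => //; exists B.
move: uS; rewrite !inE (negbTE uNS) orbF => /eqP uv.
move: B mB; rewrite uv => B mB.
exists ((fun o => Z^~ o) @^-1` (g @^-1` B)); split.
  by apply: (sigmaRV_sub DS); apply: sigmaRV_comp; exact: mg.
by move=> o /ZE /= <-.
Qed.

End SigmaRV.

(** * Conditional independence given a set of variables *)

Section CondIndep.
Context (R : realType) (V : finType) (dv : V -> measure_display)
  (T : forall v, measurableType (dv v))
  (dO : measure_display) (O : measurableType dO) (P : probability O R)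
  (Z : forall v, O -> T v).
Hypothesis mZ : forall v, measurable_fun setT (Z v).
Local Notation sg S := (sigmaRV Z S).
Local Notation OS S := (g_sigma_algebraType (sigmaRV_gen Z S)).
Implicit Types A B C D : {set V}.

(* X_A is independent of X_B given X_C, in the form P(E | X_A, X_C) = P(E | X_C)
   for E in the sigma-algebra of X_B: weak union is then immediate. *)
Definition ci A B C : Prop :=
  forall E, sg B E -> exists g : O -> R, [/\ forall x, 0 <= g x,
    @measurable_fun _ _ (OS C) _ setT g &
    forall G, sg (A :|: C)%SET G ->
      (\int[P]_(x in G) (g x)%:E = P (E `&` G))%E].

Lemma measurable_fun_sigmaRV A B (g : O -> R) : (A \subset B)%SET ->
  @measurable_fun _ _ (OS A) _ setT g -> @measurable_fun _ _ (OS B) _ setT g.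
Proof.
by move=> AB mg _ K mK; exact: (sigmaRV_sub AB) (mg measurableT K mK).
Qed.

(** A version [g] stays measurable when [C] grows, and it is tested on no more events than before;
    shifting part of [A] into [C] is weak union. *)
Lemma ci_sub A A' B B' C C' : (B' \subset B)%SET -> (C \subset C')%SET ->
  (A' :|: C' \subset A :|: C)%SET -> ci A B C -> ci A' B' C'.
Proof.
move=> BB CC AC AB E /(sigmaRV_sub BB) /AB[g [g0 mg gE]].
exists g; split => //; first exact: measurable_fun_sigmaRV mg.
by move=> G /(sigmaRV_sub AC)/gE.
Qed.

(** By the pi-system argument the test events are rectangles; there the pull-out rule is applied
    twice, to the version [g] for [E] and to the version [k] for [EB], each given [C]. *)
Lemma ci_sym A B C : ci A B C -> ci B A C.
Proof.
move=> AB E sE.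
have mE := sigmaRV_measurable mZ sE.
have genm := sigmaRV_gen_measurable mZ.
have [g [g0 mg gE gpull]] := conditional_probability_exists P (genm C) mE.
exists g; split => // G sG.
have mg' : measurable_fun setT g by exact: measurable_fun_sub mg.
rewrite setIC.
apply: (@integral_eq_measure_pi _ _ _ P (mrestr P mE) (rectangles Z B C)) => //.
- exact: rectangles_measurable.
- exact: rectanglesI.
- exact: rectanglesT.
- move=> _ [EB [EC [sB sC ->]]].
  have mB := sigmaRV_measurable mZ sB.
  have mC := sigmaRV_measurable mZ sC.
  have [k [k0 mk kE]] := AB _ sB.
  have kC H : sg C H -> (\int[P]_(x in H) (k x)%:E = P (EB `&` H))%E.
    by move=> sH; apply: kE; exact: (sigmaRV_sub (finset.subsetUr A C)).
  (* [EB] is replaced by the factor [k], then the factor [g] by [E], and [kE] evaluates the rest on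
     an event of [A :|: C]. *)
  rewrite setIC -(@conditional_probability_pullout _ _ _ P _ (genm C) EB k g)//.
  under eq_integral do rewrite mulrC.
  rewrite gpull// kE.
    by rewrite /= /mrestr; congr (P _); rewrite setIA (setIC EC).
  apply: sigmaRVI.
    exact: (sigmaRV_sub (finset.subsetUr A C)).
  exact: (sigmaRV_sub (finset.subsetUl A C)).
- exact: sigmaRV_rectangles.
Qed.

End CondIndep.

Lemma ge0_integral_eq_off_null (R : realType) (d : measure_display)
    (O : measurableType d) (mu : {measure set O -> \bar R}) (f : O -> \bar R)
    (N E E' : set O) :
  measurable N -> mu N = 0%E -> measurable E -> measurable E' ->
  (forall o, ~ N o -> (E o <-> E' o)) ->
  measurable_fun setT f -> (forall x, 0 <= f x)%E ->
  (\int[mu]_(x in E) f x = \int[mu]_(x in E') f x)%E.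
Proof.
move=> mN N0 mE mE' EE' mf f0.
rewrite (@ge0_negligible_integral _ _ _ mu E N)//; last exact: measurable_funTS.
rewrite (@ge0_negligible_integral _ _ _ mu E' N)//; last exact: measurable_funTS.
suff -> : E `\` N = E' `\` N by [].
by apply/seteqP; split=> x [Ex Nx]; split=> //; apply/EE'.
Qed.

(** * Independence of the exogenous variables *)

Section Independence.
Context (R : realType) (V : finType) (W : {set V}) (dv : V -> measure_display)
  (T : forall v, measurableType (dv v))
  (dO : measure_display) (O : measurableType dO) (P : probability O R)
  (Z : forall v, O -> T v).
Hypothesis mZ : forall v, measurable_fun setT (Z v).
Hypothesis indZ : exo_independent W P Z.
Local Notation sg S := (sigmaRV Z S).
Implicit Types A B C D : {set V}.

(** The intersection always runs over all of [W], with trivial conditions off [A], because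
    [exo_independent] speaks of full products only. *)
Definition cylinders A : set (set O) :=
  [set F | exists2 K : forall v, set (T v),
     (forall v, measurable (K v) /\ (v \notin A -> K v = setT)) &
     F = \bigcap_(w in [set w | w \in W]) (Z w @^-1` K w)].

Lemma cylinders_measurable A : cylinders A `<=` measurable.
Proof.
move=> _ [K mK ->]; apply: fin_bigcap_measurable => // w _.
by rewrite -[_ @^-1` _]setTI; apply: mZ => //; exact: (mK w).1.
Qed.

Lemma cylindersI A : setI_closed (cylinders A).
Proof.
move=> _ _ [K mK ->] [L mL ->]; exists (fun v => K v `&` L v).
  move=> v; have [mKv KT] := mK v; have [mLv LT] := mL v; split.
    exact: measurableI.
  by move=> vA; rewrite KT// LT// setIT.
by rewrite -bigcapI.
Qed.

Lemma cylindersT A : cylinders A setT.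
Proof.
exists (fun=> setT) => //.
by apply/seteqP; split=> // o _ w _.
Qed.

Lemma sigmaRV_cylinders A : (A \subset W)%SET -> sg A `<=` <<s cylinders A >>.
Proof.
move=> /fintype.subsetP AW.
apply: smallest_sub; first exact: smallest_sigma_algebra.
move=> _ [v [vA [C [mC ->]]]]; apply: sub_sigma_algebra.
exists (dfwith (fun=> setT) v C).
  move=> u; case: dfwithP => [|w vw]; first by rewrite vA.
  by split.
apply/seteqP; split=> [x Cx w wW|x /(_ v (AW _ vA))]; last first.
  by rewrite /= dfwithin.
by rewrite /=; case: dfwithP.
Qed.

(** [exo_independent] is used for the intersection and for each event; at every index one of the two
    conditions is trivial, so the factors match. *)
Lemma cylinders_indep A B F G : [disjoint A & B]%B ->
  cylinders A F -> cylinders B G -> P (F `&` G) = (P F * P G)%E.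
Proof.
move=> AB cF cG.
have mF := cylinders_measurable cF; have mG := cylinders_measurable cG.
have [H mH FG] : cylinders [set: V]%SET (F `&` G).
  have sub C C' : (C \subset C')%SET -> cylinders C `<=` cylinders C'.
    move=> /fintype.subsetP CC' _ [K mK ->]; exists K => // v.
    have [mKv KT] := mK v; split=> // vC'; apply: KT.
    by apply: contraNN vC'; exact: CC'.
  by apply: cylindersI; apply: (sub _ _ (finset.subsetT _)); eassumption.
have mFG : measurable (F `&` G) by exact: measurableI.
rewrite -[LHS]fineK ?fin_num_measure// -[P F]fineK ?fin_num_measure//.
rewrite -[P G]fineK ?fin_num_measure// -EFinM; congr EFin.
case: cF cG => [K mK ->] [L mL ->]; rewrite -bigcapI.
rewrite (indZ (B := fun w => K w `&` L w)); last first.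
  by move=> w _; apply: measurableI; [exact: (mK w).1|exact: (mL w).1].
rewrite indZ; last by move=> w _; exact: (mK w).1.
rewrite indZ; last by move=> w _; exact: (mL w).1.
rewrite -big_split /=; apply: eq_bigr => w _.
have [wA|wA] := boolP (w \in A).
  have wB : w \notin B by rewrite (disjointFr AB wA).
  by rewrite ((mL w).2 wB) preimage_setT setIT probability_setT mulr1.
by rewrite ((mK w).2 wA) preimage_setT setTI probability_setT mul1r.
Qed.

(** The product is an integral of the constant [P E], so [integral_eq_measure_pi] applies. *)
Lemma indep_pi (H : set (set O)) (E : set O) : measurable E ->
  H `<=` measurable -> setI_closed H -> H setT ->
  (forall G, H G -> P (E `&` G) = (P E * P G)%E) ->
  forall G, <<s H >> G -> P (E `&` G) = (P E * P G)%E.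
Proof.
move=> mE Hm HI HT HE G sG.
have cstE F : measurable F -> (\int[P]_(x in F) (fine (P E))%:E = P E * P F)%E.
  by move=> mF; rewrite integral_cst// fineK// fin_num_measure.
rewrite -cstE; last exact: (sub_generated_measurable Hm).
rewrite setIC; apply/esym.
apply: (@integral_eq_measure_pi _ _ _ P (mrestr P mE) H (fun=> fine (P E))) => //.
  by move=> _; exact: fine_ge0.
move=> F HF; rewrite cstE; last exact: Hm.
by rewrite -HE// /= /mrestr setIC.
Qed.

Lemma sigmaRV_indep A B E F : (A \subset W)%SET -> (B \subset W)%SET ->
  [disjoint A & B]%B -> sg A E -> sg B F -> P (E `&` F) = (P E * P F)%E.
Proof.
move=> AW BW AB sE sF.
apply: (indep_pi (H := cylinders B)); last exact: sigmaRV_cylinders.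
- exact: sigmaRV_measurable sE.
- exact: cylinders_measurable.
- exact: cylindersI.
- exact: cylindersT.
move=> G cG; rewrite setIC muleC.
apply: (indep_pi (H := cylinders A)); last exact: sigmaRV_cylinders.
- exact: cylinders_measurable cG.
- exact: cylinders_measurable.
- exact: cylindersI.
- exact: cylindersT.
by move=> K cK; rewrite setIC muleC; exact: (cylinders_indep AB cK cG).
Qed.

(* Weak union from the unconditional independence of A :|: C and B :\: C. *)
Lemma ci_exogenous A B C : (A \subset W)%SET -> (B \subset W)%SET ->
  (C \subset W)%SET -> (A :&: B \subset C)%SET -> ci P Z A B C.
Proof.
move=> AW BW CW /fintype.subsetP ABC.
(* Given no variables, the constant [P E] is a version. *)
have AC_B : ci P Z (A :|: C) (B :\: C) finset.set0.
  move=> E sE; have mE := sigmaRV_measurable mZ sE.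
  exists (fun=> fine (P E)); split.
  - by move=> _; exact: fine_ge0.
  - exact: measurable_cst.
  - rewrite finset.setU0 => G sG; have mG := sigmaRV_measurable mZ sG.
    rewrite integral_cst// fineK ?fin_num_measure//.
    rewrite -(@sigmaRV_indep (B :\: C) (A :|: C))//.
    + exact: fintype.subset_trans (finset.subsetDl _ _) BW.
    + by rewrite finset.subUset AW.
    + rewrite -finset.setI_eq0 -finset.subset0; apply/fintype.subsetP => v.
      rewrite !inE => /andP[/andP[vC vB] /orP[vA|]]; last by rewrite (negbTE vC).
      by have := ABC v; rewrite inE vA vB (negbTE vC) => /(_ isT).
(* [B :\: C] can grow to [B] in the place where it is joined with [C], hence the two symmetries. *)
apply: ci_sym => //; apply: (@ci_sub _ _ _ _ _ _ P Z (B :\: C) B A A C C) => //.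
  by apply/fintype.subsetP => v; rewrite !inE; case: (v \in C).
apply: ci_sym => //; apply: ci_sub AC_B => //; first exact: finset.sub0set.
by rewrite finset.setU0.
Qed.

End Independence.

(** * Determined variables and the product form *)

Section CondIndepProperties.
Context (R : realType) (V : finType) (dv : V -> measure_display)
  (T : forall v, measurableType (dv v))
  (dO : measure_display) (O : measurableType dO) (P : probability O R)
  (Z : forall v, O -> T v).
Hypothesis mZ : forall v, measurable_fun setT (Z v).
Local Notation sg S := (sigmaRV Z S).
Implicit Types A B C D : {set V}.

(** [v] adds no events to those of [A :|: C] up to a null set, so the same version [k] serves. *)
Lemma ci_determined A B C D v (g : cfg T -> T v) :
  (D \subset A :|: C)%SET -> meas_on D g ->
  {ae P, forall o, Z v o = g (Z^~ o)} ->
  ci P Z A B C -> ci P Z (v |: A) B C.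
Proof.
move=> DAC mg [N [mN N0 subN]] AB E sE.
have Zg o : ~ N o -> Z v o = g (Z^~ o).
  by move=> No; apply: contrapT => /subN.
have [k [k0 mk kE]] := AB _ sE.
exists k; split => // G; rewrite -finset.setUA => sG.
have [G' [sG' GG']] := sigmaRV_determined DAC mg Zg sG.
have mE := sigmaRV_measurable mZ sE.
have mG := sigmaRV_measurable mZ sG; have mG' := sigmaRV_measurable mZ sG'.
rewrite (@ge0_integral_eq_off_null _ _ _ P _ N G G')//; last first.
  apply/measurable_EFinP.
  exact: (measurable_fun_sub (sigmaRV_gen_measurable mZ (S:=C))).
rewrite kE//.
have mEG := measurableI _ _ mE mG; have mEG' := measurableI _ _ mE mG'.
(* Probabilities are written as integrals of 1, so that the lemma on null sets applies to them
   too. *)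
rewrite -[LHS]mul1e -[RHS]mul1e -!integral_cst//.
apply: (@ge0_integral_eq_off_null _ _ _ P _ N) => // o No.
by split=> -[Eo /GG' Go]; split=> //; exact: Go.
Qed.

(** The pull-out rule trades the factor [gA] for [EA], and [gB] may be tested on events that involve
    [A]: hence [gA * gB] is itself a version for the intersection. *)
Lemma ci_cond_indep A B C : ci P Z A B C -> cond_indep P (sg A) (sg B) (sg C).
Proof.
move=> AB EA EB sA sB.
have mA := sigmaRV_measurable mZ sA; have mB := sigmaRV_measurable mZ sB.
have genm := sigmaRV_gen_measurable mZ.
have [gA [gA0 mgA gAE gApull]] := conditional_probability_exists P (genm C) mA.
have [gB [gB0 mgB gBE]] := AB _ sB.
have cond_probP E (g : O -> R) : measurable E -> (forall x, 0 <= g x) ->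
    @measurable_fun _ _ (g_sigma_algebraType (sigmaRV_gen Z C)) _ setT g ->
    (forall G, sg C G -> (\int[P]_(x in G) (g x)%:E = P (E `&` G))%E) ->
    cond_prob P (sg C) E g.
  move=> mE g0 mg gE; split => //.
    by move=> K mK; have := mg measurableT K mK; rewrite setTI.
  apply/integrableP; split.
    by apply/measurable_EFinP; exact: (measurable_fun_sub (genm C)).
  under eq_integral do rewrite /= ger0_norm//.
  rewrite gE; last exact: sigmaRVT.
  by rewrite setIT; exact: (le_lt_trans (probability_le1 P mE)) (ltry _).
have gBC G : sg C G -> (\int[P]_(x in G) (gB x)%:E = P (EB `&` G))%E.
  by move=> sG; apply: gBE; exact: (sigmaRV_sub (finset.subsetUr A C)).
exists gA, gB, (fun x => gA x * gB x); split.
- exact: cond_probP.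
- exact: cond_probP.
- apply: cond_probP.
  + exact: measurableI.
  + by move=> x; rewrite mulr_ge0.
  + exact: measurable_funM.
  + move=> G sG; under eq_integral do rewrite mulrC.
    rewrite gApull// gBE.
      by rewrite setIA setIC setIA.
    apply: sigmaRVI.
      exact: (sigmaRV_sub (finset.subsetUr A C)).
    exact: (sigmaRV_sub (finset.subsetUl A C)).
- exact: aeW.
Qed.

End CondIndepProperties.

(** * Open walks and d-separation *)

Section Walks.
Variables (V : finType) (dir bi : V -> V -> Prop).
Implicit Types (S A B C D : {set V}) (st : seq (ekind * V)).
Local Notation walk S := (walk_from dir bi S).
Local Notation dsep S := (dsep dir bi S).

Lemma walk_from_sub S S' x st : (S' \subset S)%SET -> walk S' x st -> walk S x st.
Proof.
move=> /fintype.subsetP S'S; elim: st x => [//|[k y] st IH] x /= [/S'S yS xy w].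
by split=> //; exact: IH.
Qed.

Lemma walk_from_cat S x st st' :
  walk S x (st ++ st') <-> walk S x st /\ walk S (last x (map snd st)) st'.
Proof.
elim: st x => [|[k y] st IH] x /=; first by split=> [|[]].
split=> [[yS xy /IH[w w']]|[[yS xy w] w']]; first by [].
by split=> //; apply/IH.
Qed.

Lemma open_from_congr S C C' k x st : (forall u, u \in S -> (u \in C) = (u \in C')) ->
  x \in S -> walk S x st -> open_from C k x st -> open_from C' k x st.
Proof.
move=> CC'; elim: st x k => [|[j y] st IH] x k xS /=; first by rewrite CC'.
by rewrite CC'// => -[yS _ w] [ox oy]; split=> //; exact: IH.
Qed.

Lemma walk_open_congr S C C' x st : (forall u, u \in S -> (u \in C) = (u \in C')) ->
  x \in S -> walk S x st -> walk_open C x st -> walk_open C' x st.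
Proof.
move=> CC' xS; rewrite /walk_open CC'//; case: st => [//|[k y] st] [yS _ w] [? oy].
by split=> //; exact: (open_from_congr CC' yS w oy).
Qed.

(** The two added edges have their tails at the ends of the walks, which become non-colliders and
    already lie outside [C]; [v] is a collider in [C]. *)
Lemma open_from_collider C k x v p st st' :
  v \in C -> open_from C k x st -> walk_open C p st' ->
  open_from C k x (st ++ (Fwd, v) :: (Bwd, p) :: st').
Proof.
move=> vC; elim: st x k => [|[j y] st IH] x k /=.
  move=> xC [pC op]; rewrite andbF vC; split=> //; split=> //.
  by case: st' op => [//|[i z] st'] /=.
by case=> [ox oy] op; split=> //; exact: IH.
Qed.

Lemma walk_open_collider C a v p st st' :
  v \in C -> walk_open C a st -> walk_open C p st' ->
  walk_open C a (st ++ (Fwd, v) :: (Bwd, p) :: st').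
Proof.
move=> vC; case: st => [|[k y] st] [aC oa] op; split=> //.
  move: op => [pC op] /=; rewrite vC; split=> //.
  by case: st' op => [//|[i z] st'] /=.
exact: open_from_collider.
Qed.

Lemma dsep_sub S S' A A' B B' C : (S' \subset S)%SET -> (A' \subset A)%SET ->
  (B' \subset B)%SET -> dsep S A B C -> dsep S' A' B' C.
Proof.
move=> S'S /fintype.subsetP A'A /fintype.subsetP B'B sep a st aA aS lB w.
apply: sep; [exact: A'A|exact: (fintype.subsetP S'S)|exact: B'B|].
exact: walk_from_sub w.
Qed.

(** The walk without steps is open at any vertex outside [C]. *)
Lemma dsep_disjoint S A B C a : dsep S A B C -> a \in S ->
  a \in A -> a \in B -> a \in C.
Proof.
by move=> sep aS aA aB; apply/negPn/negP => aC; exact: (sep a [::]).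
Qed.

(* A walk from or to a parent p of v extends to v through p -> v; walks are not
   reversed, hence the two versions. *)
Lemma dsep_parents_l S A B C D v : dsep S A B C -> v \in S -> v \in A ->
  v \notin C -> (forall x, x \in D -> dir x v) ->
  dsep S (A :|: (D :\: C)) B C.
Proof.
move=> sep vS vA vC Dv a st; rewrite !inE => /orP[|/andP[aC /Dv av]] aS.
  exact: sep.
move=> lB w o; apply: (sep v ((Bwd, a) :: st)) => //=; split=> //.
by move: o; rewrite /walk_open; case: st {lB w} => [|[k y] st] /= [].
Qed.

Lemma dsep_parents_r S A B C D v : dsep S A B C -> v \in S -> v \in B ->
  v \notin C -> (forall x, x \in D -> dir x v) ->
  dsep S A (B :|: (D :\: C)) C.
Proof.
move=> sep vS vB vC Dv a st aA aS.
rewrite !inE => /orP[lB|/andP[lC /Dv lv]]; first exact: sep.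
move=> w o; apply: (sep a (st ++ [:: (Fwd, v)])) => //.
- by rewrite map_cat last_cat.
- by apply/walk_from_cat; split.
have extend k x st' : open_from C k x st' -> open_from C k x (st' ++ [:: (Fwd, v)]).
  elim: st' x k => [|[j y] st' IH] x k /=; first by rewrite andbF.
  by case=> ox /IH.
by case: st o {lC lv w} => [|[k y] st] [aC /= o]; split=> //=; exact: extend.
Qed.

(* Conditioning on the sink v joins the walks that reach its parents, so these
   are reachable from at most one of A and B. *)
Lemma dsep_sink_conditioned S A B C D v : dsep S A B C -> v \in S -> v \in C ->
  (forall x, x \in D -> x \in (S :\ v)%SET /\ dir x v) ->
  let S' := (S :\ v)%SET in let C' := (C :\ v)%SET in
  dsep S' (A :|: (D :\: C')) B C' \/ dsep S' A (B :|: (D :\: C')) C'.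
Proof.
move=> sep vS vC Dv S' C'.
have S'S : (S' \subset S)%SET by exact: finset.subsetDl.
have CC' u : u \in S' -> (u \in C') = (u \in C).
  by rewrite !inE => /andP[->].
have sep' : dsep S' A B C'.
  move=> a st aA aS lB w o; apply: (sep a st) => //.
  - exact: (fintype.subsetP S'S).
  - exact: walk_from_sub w.
  - exact: walk_open_congr w o.
apply: contrapT => /not_orP[nl nr].
apply: nl => p st'; rewrite !inE => /orP[pA|/andP[pC pD]] pS lB w' o'.
  by apply: (sep' p st') => //; rewrite !inE.
apply: nr => a st aA aS; rewrite !inE => /orP[lB'|/andP[lC lD]] w o.
  exact: (sep' a st).
have [lS' lv] := Dv _ lD; have [pS' pv] := Dv _ pD.
apply: (sep a (st ++ (Fwd, v) :: (Bwd, p) :: st')) => //.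
- exact: (fintype.subsetP S'S).
- by rewrite map_cat last_cat.
- apply/walk_from_cat; split; first exact: walk_from_sub w.
  split=> //; split=> //; first exact: (fintype.subsetP S'S).
  exact: walk_from_sub w'.
- apply: walk_open_collider => //.
  + exact: walk_open_congr w o.
  + by apply: walk_open_congr w' o'.
Qed.

End Walks.

(** * Global Markov property of acyclic functional systems *)

Section GlobalMarkov.
Context (R : realType) (V : finType) (W : {set V}) (dv : V -> measure_display)
  (T : forall v, measurableType (dv v))
  (dO : measure_display) (O : measurableType dO) (P : probability O R)
  (Z : forall v, O -> T v).
Hypothesis mZ : forall v, measurable_fun setT (Z v).
Hypothesis indZ : exo_independent W P Z.
Variables (dir bi : V -> V -> Prop) (rk : V -> nat).
Implicit Types A B C D S : {set V}.

(** Deterministic structural equations within [S]; the rank makes the system acyclic, exogenous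
    arguments being exempt. *)
Definition functional S := forall v, v \in S -> v \notin W ->
  exists D (g : cfg T -> T v),
    [/\ forall x, x \in D -> [/\ x \in S, dir x v & (x \in W) || (rk x < rk v)%N],
        meas_on D g & {ae P, forall o, Z v o = g (Z^~ o)}].

(** Arguments of an equation are exogenous or of smaller rank, so no remaining equation mentions
    [v]. *)
Lemma functional_remove_sink S v : v \notin W ->
  (forall u, u \in S -> u \notin W -> (rk u <= rk v)%N) ->
  functional S -> functional (S :\ v).
Proof.
move=> vW vmax fS u; rewrite !inE => /andP[uv uS] uW.
have [D [g [Dg mg gE]]] := fS u uS uW.
exists D, g; split=> // x xD; have [xS xu xrk] := Dg x xD.
split=> //; rewrite !inE xS andbT; apply/eqP => xv.
by move: xrk; rewrite xv (negbTE vW) /= ltnNge vmax.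
Qed.

Theorem functional_global_markov S : functional S ->
  forall A B C, (A \subset S)%SET -> (B \subset S)%SET -> (C \subset S)%SET ->
  dsep dir bi S A B C -> ci P Z A B C.
Proof.
have [n] := ubnP #|S :\: W|; elim: n S => // n IH S Sn fS A B C AS BS CS sep.
have [SW0|] := eqVneq (S :\: W)%SET finset.set0.
  have SW : (S \subset W)%SET by rewrite -finset.setD_eq0 SW0.
  apply: (ci_exogenous mZ indZ); [exact: fintype.subset_trans AS SW|exact: fintype.subset_trans BS SW|exact: fintype.subset_trans CS SW|].
  apply/fintype.subsetP => v; rewrite inE => /andP[vA vB].
  by apply: (dsep_disjoint sep) => //; exact: (fintype.subsetP AS).
case/finset.set0Pn => v0 v0S.
case: (@arg_maxnP _ v0 (mem (S :\: W)%SET) rk v0S) => v vSW vmax.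
have /andP[vW vS] : (v \notin W) && (v \in S) by rewrite -finset.in_setD.
set S' := (S :\ v)%SET.
have fS' : functional S'.
  by apply: functional_remove_sink => // u uS uW; apply/vmax/finset.setDP; split.
have S'n : (#|S' :\: W| < n)%N.
  apply: leq_trans (_ : #|S :\: W| <= n)%N; last by rewrite -ltnS.
  apply: proper_card; apply/fintype.properP; split.
    by apply: finset.setSD; exact: finset.subsetDl.
  by exists v => //; rewrite !inE eqxx andbF.
have S'S : (S' \subset S)%SET by exact: finset.subsetDl.
have toS' A' : (A' \subset S)%SET -> v \notin A' -> (A' \subset S')%SET.
  by move=> A'S vA'; rewrite /S' finset.subsetD1 A'S.
have [D [g [Dg mg gE]]] := fS v vS vW.
have DS' x : x \in D -> x \in S' /\ dir x v.
  move=> xD; have [xS xv xrk] := Dg x xD; split=> //.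
  rewrite !inE xS andbT; apply/eqP => xv'; move: xrk.
  by rewrite xv' (negbTE vW) ltnn.
have DsubS' : (D \subset S')%SET by apply/fintype.subsetP => x /DS'[].
have Ddir x : x \in D -> dir x v by move=> /DS'[].
have [vC|vC] := boolP (v \in C).
  (* Stripped of [C], both sets lose [v] and fit into [S']; the stripped part is regained through
     [C0], as it is joined with [C] anyway. *)
  pose A0 := (A :\: C)%SET; pose B0 := (B :\: C)%SET; pose C' := (C :\ v)%SET.
  have A0S' : (A0 \subset S')%SET.
    by apply: toS'; [exact: fintype.subset_trans (finset.subsetDl _ _) AS|rewrite inE vC].
  have B0S' : (B0 \subset S')%SET.
    by apply: toS'; [exact: fintype.subset_trans (finset.subsetDl _ _) BS|rewrite inE vC].
  have C'S' : (C' \subset S')%SET by exact: finset.setSD.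
  have DC'S' : (D :\: C' \subset S')%SET.
    exact: fintype.subset_trans (finset.subsetDl _ _) DsubS'.
  have vC' : (v |: C')%SET = C by rewrite finset.setD1K.
  have DUC' A' : (D \subset (A' :|: (D :\: C')) :|: C')%SET.
    by apply/fintype.subsetP => x xD; move: (C') => K; rewrite !inE xD andbT; case: (x \in K); rewrite ?orbT.
  (* [v] is determined by its parents, hence joins the left set by [ci_determined], and weak union
     moves it to the conditioning set. *)
  have absorb A' B' : ci P Z (A' :|: (D :\: C')) B' C' -> ci P Z A' B' C.
    move=> /(ci_determined mZ (DUC' A') mg gE); apply: ci_sub => //.
      exact: finset.subsetDl.
    rewrite -[in X in X \subset _]vC'; apply/fintype.subsetP => x.
    by rewrite !inE; do ![case/orP || case/andP || move=> ->]; rewrite ?orbT.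
  suff AB0 : ci P Z A0 B0 C.
    have C0 A' : (A' :|: C \subset (A' :\: C) :|: C)%SET.
      by apply/fintype.subsetP => x; rewrite !inE; case: (x \in C).
    apply: ci_sym => //; apply: (ci_sub _ _ (C0 B)) => //.
    apply: ci_sym => //; exact: (ci_sub _ _ (C0 A) AB0).
  have sep0 : dsep dir bi S A0 B0 C by apply: dsep_sub sep => //; exact: finset.subsetDl.
  have [sep'|sep'] := dsep_sink_conditioned sep0 vS vC DS'.
    apply: absorb; apply: IH sep' => //.
    by rewrite finset.subUset A0S'.
  apply: ci_sym => //; apply: absorb; apply: ci_sym => //; apply: IH sep' => //.
  by rewrite finset.subUset B0S'.
have CS' := toS' _ CS vC.
have DCS' : (D :\: C \subset S')%SET.
  exact: fintype.subset_trans (finset.subsetDl _ _) DsubS'.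
have remS' A' : (A' \subset S)%SET -> ((A' :\ v) :|: (D :\: C) \subset S')%SET.
  by move=> A'S; rewrite finset.subUset DCS' andbT; exact: finset.setSD.
(* Here [v] itself belongs to the left set and is recovered from its parents, those in [C] being
   conditioned on. *)
have absorb A' B' : v \in A' -> ci P Z ((A' :\ v) :|: (D :\: C)) B' C -> ci P Z A' B' C.
  move=> vA' /ci_determined -/(_ mZ D v g) H; apply: ci_sub (H _ mg gE) => //.
  - rewrite finset.setUA finset.setD1K//; apply/fintype.subsetP => x.
    by rewrite !inE => /orP[->|->]; rewrite ?orbT.
  - by apply/fintype.subsetP => x xD; rewrite !inE xD andbT; case: (x \in C); rewrite ?orbT.
have [vA|vA] := boolP (v \in A).
  have vB : v \notin B by apply: contraNN vC => vB; exact: (dsep_disjoint sep).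
  apply: absorb => //; apply: (IH S') => //; [exact: remS'|exact: toS'|].
  apply: dsep_sub (dsep_parents_l sep vS vA vC Ddir) => //.
  by apply: finset.setSU; exact: finset.subsetDl.
have [vB|vB] := boolP (v \in B).
  apply: ci_sym => //; apply: absorb => //; apply: ci_sym => //.
  apply: (IH S') => //; [exact: toS'|exact: remS'|].
  apply: dsep_sub (dsep_parents_r sep vS vB vC Ddir) => //.
  by apply: finset.setSU; exact: finset.subsetDl.
by apply: (IH S') => //; [exact: toS'..|exact: dsep_sub sep].
Qed.

End GlobalMarkov.

(** * The solution as a functional system *)

Section FunctionalRepresentation.
Context (R : realType) (V F : finType) (W : {set V}) (Vf : F -> {set V})
  (dv : V -> measure_display) (T : forall v, measurableType (dv v))
  (dY : measure_display) (Y : measurableType dY)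
  (c : F -> Y) (phi : F -> cfg T -> Y)
  (dO : measure_display) (O : measurableType dO) (P : probability O R)
  (X : forall v, O -> T v) (h : cfg T -> cfg T).
Hypothesis HXm : forall w, w \in W -> measurable_fun setT (X w).
Hypothesis Hh : is_solution W c phi P X h.
Local Notation Z := (Xstar W X h).

Lemma Xstar_exogenous w : w \in W -> Z w = X w.
Proof. by move=> wW; apply/funext => o; rewrite /Xstar wW. Qed.

(** Only the exogenous [X w] are known to be measurable, so [h] is composed inside the sigma-algebra
    of the [W] coordinates. *)
Lemma Xstar_measurable v : measurable_fun setT (Z v).
Proof.
have [vW|vW] := boolP (v \in W); first by rewrite Xstar_exogenous//; exact: HXm.
move=> _ B mB; rewrite setTI.
have -> : Z v @^-1` B = XW X @^-1` ((fun x => h x v) @^-1` B).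
  by apply/seteqP; split=> o; rewrite /= /Xstar (negbTE vW).
have sub : sigmaRV X W `<=` measurable.
  apply: sub_generated_measurable => _ [w [wW [K [mK ->]]]].
  by rewrite -[_ @^-1` _]setTI; exact: HXm.
apply: sub; apply: (@sigmaRV_comp _ _ _ _ _ X W ((fun x => h x v) @^-1` B)).
exact: (Hh.1 v vW B mB).
Qed.

Lemma exo_independent_Xstar : exo_independent W P X -> exo_independent W P Z.
Proof.
move=> indX B mB.
transitivity (fine (P (\bigcap_(w in [set w | w \in W]) (X w @^-1` B w)))).
  congr (fine (P _)); apply: eq_bigcapr => w /= wW.
  by rewrite Xstar_exogenous.
by rewrite indX//; apply: eq_bigr => w wW; rewrite Xstar_exogenous.
Qed.

(** The solution meets the constraints of [SF] almost surely, and unique solvability turns them into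
    the equations for [SV]. *)
Lemma uniquely_solvable_functional (SF : {set F}) (SV : {set V}) v : v \in SV -> v \notin W ->
  uniquely_solvable_wrt W Vf c phi P X SF SV ->
  exists g : cfg T -> T v, meas_on (VofF Vf SF :\: SV)%SET g /\
    {ae P, forall o, Z v o = g (Z^~ o)}.
Proof.
move=> vSV vW [g [mg gE]]; exists (fun x => g x v); split; first exact: mg.
apply: filterS2 gE Hh.2 => o gE hE.
transitivity (h (XW X o) v); first by rewrite /Xstar (negbTE vW).
(* [mixW (h (XW X o)) o] and [Z^~ o] are the same configuration by definition. *)
exact: (gE (h (XW X o))).2 (fun f _ => hE f) v vSV.
Qed.

Lemma max_uniquely_solvable_functional s : alg1_run Vf (TC Vf W) s ->
  max_uniquely_solvable W Vf c phi P X s ->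
  functional W P Z (MO_dir Vf W s) (cluster_rank Vf W s) (VCO Vf W).
Proof.
move=> run [us _] v vVCO vW.
have [C [Cc CW CTI vC parents]] := endogenous_cluster run vVCO vW.
have vSV : v \in [set v | inl v \in C]%SET by rewrite inE.
have [g [mg gE]] := uniquely_solvable_functional vSV vW (us C Cc CW CTI).
exists (VofF Vf [set f | inr f \in C] :\: [set v | inl v \in C])%SET, g.
split=> // x /finset.setDP[/finset.bigcupP[f fC xf] xC].
by apply: (parents f) => //; [rewrite inE in fC|rewrite inE in xC].
Qed.

End FunctionalRepresentation.

Theorem theorem17 (R : realType) (V F : finType) (W : {set V})
  (Vf : F -> {set V})
  (dv : V -> measure_display) (T : forall v, measurableType (dv v))
  (HT : forall v, standard_measurable R (T v))
  (dY : measure_display) (Y : measurableType dY)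
  (HY : standard_measurable R Y)
  (c : F -> Y) (phi : F -> cfg T -> Y)
  (Hphi : forall f, meas_on (Vf f) (phi f))
  (dO : measure_display) (O : measurableType dO) (P : probability O R)
  (X : forall v, O -> T v)
  (HXm : forall w, w \in W -> measurable_fun setT (X w))
  (HXind : exo_independent W P X)
  (h : cfg T -> cfg T) (Hh : is_solution W c phi P X h)
  (s : seq {set F}) (Hrun : alg1_run Vf (TC Vf W) s)
  (Hmus : max_uniquely_solvable W Vf c phi P X s) :
  forall A B C : {set V},
    (A \subset VCO Vf W)%SET -> (B \subset VCO Vf W)%SET ->
    (C \subset VCO Vf W)%SET ->
    dsep (MO_dir Vf W s) (MO_bi Vf W s) (VCO Vf W) A B C ->
    cond_indep P (sigmaRV (Xstar W X h) A) (sigmaRV (Xstar W X h) B)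
                 (sigmaRV (Xstar W X h) C).
Proof.
move=> A B C AS BS CS sep.
have mZ := Xstar_measurable HXm Hh.
apply: ci_cond_indep => //.
exact: (functional_global_markov mZ (exo_independent_Xstar h HXind)
  (max_uniquely_solvable_functional Hh Hrun Hmus) AS BS CS sep).
Qed.
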